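(* Let $n\ge 1$ and $k\ge 1$ be integers, let $I$ be a bounded closed interval, let $c_1,c_2\in C^k(I,\mathbb{R}^n)$, and let $\lambda_1,\dots,\lambda_k>0$. Consider the energy functional $E:H^1(I,O(n))\to\mathbb{R}$, $$E(g)=E[g;c_1,c_2]=\frac12\int_I\Big(\|g(s)\cdot j^{1,k}_s c_1-j^{1,k}_s c_2\|_L^2+\|g(s)^{-1}g'(s)\|_{\mathfrak{o}(n)}^2\Big)\,ds .$$ Then $E$ attains its global minimum on $H^1(I,O(n))$. Moreover, any minimizer $g^*\in H^1(I,O(n))$ satisfies, with $\Omega(s)=g^*(s)^{-1}(g^* )'(s)$, the variational equation $$\Omega'(s)=\big(g^*(s)^{-1}j^{1,k}_s c_2\big)\diamond\big(j^{1,k}_s c_1\big)^\flat ,$$ and in particular $g^*\in C^2(I,O(n))$.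
   Context: $O(n)$ is the orthogonal group of real $n\times n$ matrices and $\mathfrak{o}(n)$ is its Lie algebra of antisymmetric matrices, with inner product $\langle\Omega,\Omega'\rangle_{\mathfrak{o}(n)}=\operatorname{tr}(\Omega^T\Omega')=-\operatorname{tr}(\Omega\Omega')$ and induced norm $\|\cdot\|_{\mathfrak{o}(n)}$. This inner product is used to identify the dual $\mathfrak{o}(n)^*$ with $\mathfrak{o}(n)$. For $c\in C^k(I,\mathbb{R}^n)$ and $s\in I$, $j^{1,k}_s c$ is the $n\times k$ matrix whose $i$-th column is $c^{(i)}(s)$, $i=1,\dots,k$. Let $V$ be the space of real $n\times k$ matrices; $O(n)$ acts on $V$ by left multiplication $g\cdot A=gA$. Put $L=\operatorname{diag}(\lambda_1,\dots,\lambda_k)$ and $\langle A,B\rangle_L=\operatorname{tr}(LA^TB)$ on $V$, with induced norm $\|\cdot\|_L$. The map $\flat:V\to V^*$ is the one induced by this inner product: $\langle B^\flat,A\rangle=\langle B,A\rangle_L$. Diamond operator: for $A,B\in V$, $A\diamond B^\flat\in\mathfrak{o}(n)^*\cong\mathfrak{o}(n)$ is defined by $\langle A\diamond B^\flat,\Omega\rangle=\langle B^\flat,\Omega A\rangle=\operatorname{tr}(LB^T\Omega A)$ for all $\Omega\in\mathfrak{o}(n)$. Under the identification $\mathfrak{o}(n)^*\cong\mathfrak{o}(n)$ given by the inner product, $A\diamond B^\flat$ is thus the unique $X\in\mathfrak{o}(n)$ with $\langle X,\Omega\rangle_{\mathfrak{o}(n)}=\operatorname{tr}(LB^T\Omega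 A)$ for all $\Omega\in\mathfrak{o}(n)$. $H^1(I,O(n))$ is the space of continuous curves $g:I\to O(n)$ that are of Sobolev class $H^1$ in charts of $O(n)$; equivalently, absolutely continuous curves with square-integrable derivative when $O(n)$ is viewed inside the space of $n\times n$ matrices. *)

(* Defs.v *)
From mathcomp Require Import all_boot all_order all_algebra.
From mathcomp Require Import all_classical all_reals all_analysis.
From HB Require Import structures.

Set Implicit Arguments.
Unset Strict Implicit.
Unset Printing Implicit Defensive.

Import Order.TTheory GRing.Theory Num.Theory.
Import numFieldNormedType.Exports.

Local Open Scope classical_set_scope.
Local Open Scope ring_scope.

(* Calculus for curves on a closed interval `[a, b], a < b. A curve is a total
   function on R; every notion below depends only on its values on `[a, b].
   Derivatives are taken within `[a, b], hence are one-sided at a and b. *)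
Section Curves.
Context {R : realType} {V : normedModType R}.
Implicit Types (a b s : R) (f : R -> V).

Definition slope_on f s (t : R) : V := (t - s)^-1 *: (f t - f s).

Definition derivable_on a b f s : Prop :=
  cvg (slope_on f s t @[t --> within `[a, b] s^']).

Definition derive_on a b f s : V :=
  lim (slope_on f s t @[t --> within `[a, b] s^']).

Definition derive_onn a b (i : nat) f : R -> V := iter i (derive_on a b) f.

Definition Ck_on (k : nat) a b f : Prop :=
  (forall i, (i < k)%N ->
     forall s, s \in `[a, b] -> derivable_on a b (derive_onn a b i f) s) /\
  (forall i, (i <= k)%N -> {within `[a, b], continuous (derive_onn a b i f)}).

Definition abs_continuous_on a b f : Prop :=
  forall e : R, 0 < e -> exists2 d : R, 0 < d &
    forall (m : nat) (u v : 'I_m -> R),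
      (forall i, a <= u i /\ u i <= v i /\ v i <= b) ->
      trivIset [set: 'I_m] (fun i => `]u i, v i[%classic) ->
      \sum_(i < m) (v i - u i) < d ->
      \sum_(i < m) `|f (v i) - f (u i)| < e.

End Curves.

Section Orthogonal.
Context {R : realType} (n : nat).

Definition orthogonal_group : set 'M[R]_n := [set g | g^T *m g = 1%:M].

Definition orthogonal_algebra : set 'M[R]_n := [set X | X^T = - X].

Definition inner_o (X Y : 'M[R]_n) : R := \tr (X^T *m Y).

Definition norm_o (X : 'M[R]_n) : R := Num.sqrt (inner_o X X).

(* The derivative of an absolutely continuous curve exists almost everywhere;
   where it does not, derive_on takes a default value, which is irrelevant to
   square integrability and to the energy. *)
Definition H1_orthogonal (a b : R) (g : R -> 'M[R]_n) : Prop :=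
  [/\ forall s, s \in `[a, b] -> orthogonal_group (g s),
      abs_continuous_on a b g &
      forall i j : 'I_n,
        ((fun s => derive_on a b g s i j) \_ `[a, b]) \in
          Lfun (@lebesgue_measure R) 2%:E].

End Orthogonal.
Arguments orthogonal_group {R} n.
Arguments orthogonal_algebra {R} n.

Section Energy.
Context {R : realType} (n k : nat).
Implicit Types (lam : 'rV[R]_k) (A B : 'M[R]_(n, k)).

Definition inner_L lam A B : R := \tr (diag_mx lam *m A^T *m B).

Definition norm_L lam A : R := Num.sqrt (inner_L lam A A).

Definition flat lam B : 'M[R]_(n, k) -> R := inner_L lam B.

Lemma flat_is_scalar lam B : scalar (flat lam B).
Proof.
by move=> x A C; rewrite /flat /inner_L mulmxDr -scalemxAr mxtraceD mxtraceZ.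
Qed.

HB.instance Definition _ lam B :=
  GRing.isLinear.Build R 'M[R]_(n, k) R *%R (flat lam B) (flat_is_scalar lam B).

(* The diamond operator with values in o(n), identified with its dual through
   inner_o; see diamondP and diamond_unique. *)
Definition diamond A (beta : {scalar 'M[R]_(n, k)}) : 'M[R]_n :=
  get [set X | orthogonal_algebra n X /\
               forall W, orthogonal_algebra n W ->
                 inner_o X W = beta (W *m A)].

Definition jet (a b : R) (c : R -> 'cV[R]_n) (s : R) : 'M[R]_(n, k) :=
  \matrix_(i < n, j < k) derive_onn a b j.+1 c s i 0.

Definition energy (a b : R) lam (c1 c2 : R -> 'cV[R]_n) (g : R -> 'M[R]_n) : R :=
  2^-1 * \int[@lebesgue_measure R]_(s in `[a, b])
    (norm_L lam (g s *m jet a b c1 s - jet a b c2 s) ^+ 2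
     + norm_o (invmx (g s) *m derive_on a b g s) ^+ 2).

Lemma inner_oE (X Y : 'M[R]_n) : inner_o X Y = \sum_i \sum_j X i j * Y i j.
Proof.
rewrite /inner_o /mxtrace exchange_big /=; apply: eq_bigr => j _.
by rewrite mxE; apply: eq_bigr => i _; rewrite mxE.
Qed.

Lemma diamondP A (beta : {scalar 'M[R]_(n, k)}) :
  orthogonal_algebra n (diamond A beta) /\
  forall W, orthogonal_algebra n W ->
    inner_o (diamond A beta) W = beta (W *m A).
Proof.
pose M : 'M[R]_n := \matrix_(i, j) beta (delta_mx i j *m A).
have betaM W : inner_o M W = beta (W *m A).
  rewrite inner_oE [in RHS](matrix_sum_delta W) mulmx_suml linear_sum /=.
  apply: eq_bigr => i _; rewrite mulmx_suml linear_sum /=.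
  by apply: eq_bigr => j _; rewrite -scalemxAl linearZ /= mxE mulrC.
apply: (getPex (P := [set X | orthogonal_algebra n X /\
  forall W, orthogonal_algebra n W -> inner_o X W = beta (W *m A)])).
exists (2^-1 *: (M - M^T)); split=> [|W skW].
  by rewrite /orthogonal_algebra /= linearZ /= linearB /= trmxK -scalerN opprB.
rewrite -betaM /inner_o linearZ /= linearB /= trmxK -scalemxAl mxtraceZ.
have MW : \tr (M *m W) = - \tr (M^T *m W).
  by rewrite -[LHS]mxtrace_tr trmx_mul skW mulNmx raddfN /= mxtrace_mulC.
rewrite mulmxBl raddfB /= MW opprK -mulr2n -(mulr_natl (\tr (M^T *m W))).
by rewrite mulKf ?pnatr_eq0.
Qed.

Lemma diamond_unique A (beta : {scalar 'M[R]_(n, k)}) (X : 'M[R]_n) :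
  orthogonal_algebra n X ->
  (forall W, orthogonal_algebra n W -> inner_o X W = beta (W *m A)) ->
  X = diamond A beta.
Proof.
move=> skX HX; have [skD HD] := diamondP A beta.
have skXD : orthogonal_algebra n (X - diamond A beta).
  by rewrite /orthogonal_algebra /= linearB /= skX skD opprB opprK addrC.
have : inner_o (X - diamond A beta) (X - diamond A beta) = 0.
  rewrite [LHS](_ : _ = inner_o X (X - diamond A beta)
                      - inner_o (diamond A beta) (X - diamond A beta)).
    by rewrite HX// HD// subrr.
  by rewrite /inner_o (linearB trmx) /= mulmxBl raddfB.
rewrite inner_oE => /eqP; rewrite psumr_eq0 => [/allP H|i _]; last first.
  by apply: sumr_ge0 => j _; rewrite -expr2 sqr_ge0.
apply/eqP; rewrite -subr_eq0; apply/eqP/matrixP => i j; rewrite [RHS]mxE.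
have /= := H i (mem_index_enum i).
rewrite psumr_eq0 => [/allP /(_ j (mem_index_enum j)) /=|l _].
  by rewrite mulf_eq0 orbb => /eqP.
by rewrite -expr2 sqr_ge0.
Qed.

End Energy.
Arguments jet {R n} k a b c s.

(* Main.v *)
Require Import Defs.
From mathcomp Require Import all_boot all_order all_algebra.
From mathcomp Require Import all_classical all_reals all_analysis.
From mathcomp Require Import measurable_realfun.
From mathcomp Require Import ring lra.
From HB Require Import structures.

Set Implicit Arguments.
Unset Strict Implicit.
Unset Printing Implicit Defensive.

Import Order.TTheory GRing.Theory Num.Theory.
Import numFieldNormedType.Exports.

Local Open Scope classical_set_scope.
Local Open Scope ring_scope.

(** The data term of the energy expands as
    [|g A - B|_L^2 = |A|_L^2 + |B|_L^2 - 2 <g A, B>_L], since [g] is orthogonal, and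
    [|g^-1 g'| = |g'|]. So up to a constant the energy is the action
    [1/2 int |g'|^2 - int <g, S>] for a continuous matrix-valued source [S]
    ([energy_action]), and both claims are about this action.

    Analytic basis. The energy only sees the derivative of an absolutely continuous
    curve, so it controls the curve through the fundamental theorem of calculus of
    Lebesgue: an absolutely continuous function is the integral of its almost
    everywhere derivative ([ac_primitive], [is_primitive_derive_ae]). It is reduced
    to monotone functions by means of the total variation ([ac_total_variation]);
    for these, the Stieltjes measure is dominated by Lebesgue measure
    ([stieltjes_dominated]), its Radon-Nikodym derivative is the density, and
    Lebesgue differentiation identifies the density with the derivative.

    Existence ([action_minimizer_exists]). A minimizing sequence has bounded
    [int |g'|^2], hence is uniformly Hoelder and uniformly absolutely continuous; by
    Tychonoff's theorem it has a pointwise cluster point, which is again orthogonal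
    and absolutely continuous. For lower semicontinuity, [int |g'|^2] is replaced by
    the discrete energies [sum |g(t_(i+1)) - g(t_i)|^2 / h]. They depend on finitely
    many values of [g], are at most [int |g'|^2] by Cauchy-Schwarz
    ([discrete_energy_le]), and recover it in the limit by Fatou's lemma
    ([discrete_energy_fatou]).

    Regularity. For [W = E_ij - E_ji] the exponential of [t W] is the explicit
    rotation [rot W t], and the variation [g rot W (e eta)] of a minimizer gives
    [int zeta <g', g W> = int eta <g W, S>] for every primitive [eta] of a
    square-integrable [zeta] ([first_variation]). The difference of [<g', g W>] and
    [s |-> int_s^b <g W, S>] is itself square-integrable; with this [zeta] and the
    primitive [eta] that vanishes at [a], an integration by parts yields
    [int zeta^2 = 0] ([momentum_ae]). As [g^-1 g'] is skew-symmetric almost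
    everywhere, it equals almost everywhere a matrix [Omega] of integrals of
    continuous functions. Then [g] is a primitive of the continuous function
    [g Omega], so that [g' = g Omega] everywhere and [g] is twice continuously
    differentiable; the derivative of [Omega] is the diamond term by
    [diamond_skew_basis].

    A minimizer among pairs of a curve and a density of it is thus smooth enough to
    belong to the original class, so that the two minimization problems agree. *)

(** * Total variation of an absolutely continuous function *)

Section TotalVariation.
Context {R : realType}.
Implicit Types (a b : R) (f : R -> R) (p q : R * R) (L : seq (R * R)).

(** The open intervals are disjoint; in this form an empty interval is disjoint
    from every other one, wherever it lies. *)
Definition disj_itv p q := Num.min p.2 q.2 <= Num.max p.1 q.1.

Definition sub_itv a b p := (a <= p.1) && ((p.1 <= p.2) && (p.2 <= b)).

Definition nonoverlapping a b L := all (sub_itv a b) L && pairwise disj_itv L.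

Definition total_length L := \sum_(p <- L) (p.2 - p.1).

Definition total_increment f L := \sum_(p <- L) `|f p.2 - f p.1|.

Lemma total_length_cons p L :
  total_length (p :: L) = p.2 - p.1 + total_length L.
Proof. by rewrite /total_length big_cons. Qed.

Lemma total_length_cat L L' :
  total_length (L ++ L') = total_length L + total_length L'.
Proof. by rewrite /total_length big_cat. Qed.

Lemma total_increment_cons f p L :
  total_increment f (p :: L) = `|f p.2 - f p.1| + total_increment f L.
Proof. by rewrite /total_increment big_cons. Qed.

Lemma total_increment_cat f L L' :
  total_increment f (L ++ L') = total_increment f L + total_increment f L'.
Proof. by rewrite /total_increment big_cat. Qed.

Lemma disj_itvP p q : p.1 <= p.2 -> q.1 <= q.2 ->
  disj_itv p q <-> `]p.1, p.2[%classic `&` `]q.1, q.2[%classic = set0.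
Proof.
move=> p12 q12; split=> [pq|pq].
  rewrite -subset0 => x [/=]; rewrite !in_itv/= => /andP[x1 x2] /andP[x3 x4].
  have : Num.max p.1 q.1 < Num.min p.2 q.2.
    by apply: (@lt_trans _ _ x); rewrite ?gt_max ?lt_min ?x1 ?x3 ?x2 ?x4.
  by rewrite ltNge -/(disj_itv p q) pq.
rewrite /disj_itv leNgt; apply/negP => h.
set x := Num.max p.1 q.1 in h; set y := Num.min p.2 q.2 in h.
suff : (set0 : set R) ((x + y) / 2) by [].
rewrite -pq; have := midf_lt h => -[xm my]; split => /=; rewrite in_itv/=.
- by rewrite (le_lt_trans _ xm) ?le_max ?lexx// (lt_le_trans my)// ge_min lexx.
- by rewrite (le_lt_trans _ xm) ?le_max ?lexx ?orbT// (lt_le_trans my)// ge_min lexx orbT.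
Qed.

Lemma disj_itv_sub p q r : q.1 <= p.1 -> p.2 <= q.2 ->
  disj_itv q r -> disj_itv p r.
Proof.
move=> h1 h2 h; apply: le_trans (le_trans h _).
  by rewrite le_min !ge_min h2 lexx orbT.
by rewrite ge_max !le_max h1 lexx orbT.
Qed.

(** Lists rather than indexed families, so that one interval can be replaced by
    the list of intervals of a partition. *)
Lemma ac_nonoverlapping a b f : abs_continuous_on a b f ->
  forall e, 0 < e -> exists2 d, 0 < d & forall L, nonoverlapping a b L ->
    total_length L < d -> total_increment f L < e.
Proof.
move=> ac e /ac[d d0 H]; exists d => // L /andP[/allP Lab Ld] len.
pose u (i : 'I_(size L)) := (nth (0, 0) L i).1.
pose v (i : 'I_(size L)) := (nth (0, 0) L i).2.
have := H _ u v; rewrite /total_length /total_increment in len *.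
rewrite !(big_nth (0, 0)) !big_mkord in len * => /(_ _ _ len); apply.
  by move=> i; have /Lab /and3P[-> -> ->] : nth (0, 0) L i \in L by rewrite mem_nth.
apply/trivIsetP => i j _ _ ij.
have LE (l : 'I_(size L)) : u l <= v l.
  by have /Lab /and3P[] : nth (0, 0) L l \in L by rewrite mem_nth.
wlog lij : i j ij / (i < j)%N => [W|].
  have [/W|] := ltnP i j; first exact.
  rewrite leq_eqVlt eq_sym -[_ == _]/(i == j) (negbTE ij)/= => ji.
  by rewrite setIC; apply: W => //; rewrite eq_sym.
apply/(@disj_itvP (u i, v i) (u j, v j)); rewrite ?LE// /disj_itv.
by move/pairwiseP : Ld => /(_ (0, 0) i j); apply; rewrite ?inE.
Qed.

Lemma itv_partition_nonoverlapping x y s : itv_partition x y s ->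
  [/\ nonoverlapping x y (zip (x :: s) s),
      total_length (zip (x :: s) s) = y - x &
      forall f, total_increment f (zip (x :: s) s) = variation x y f s].
Proof.
elim: s x => [x /itv_partition_nil ->|z s IH x xys].
  by split=> [||f]; rewrite /total_length /total_increment /variation
     ?big_nil ?subrr// big_geq.
have [ [/= /andP[xz _] _] zys] := (xys, itv_partition_cons xys).
have zy := itv_partition_le zys.
have [/andP[s1 s2] s3 s4] := IH _ zys; split => [||f].
- apply/andP; split => /=.
    rewrite /sub_itv/= lexx (ltW xz) zy/=.
    apply: sub_all s1 => p /and3P[h1 h2 h3].
    by rewrite /sub_itv h2 h3 (le_trans (ltW xz) h1).
  rewrite -/(pairwise _ _) s2 andbT; apply: sub_all s1 => p /and3P[h1 h2 h3].
  rewrite /disj_itv/= ge_min; apply/orP; left.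
  by rewrite le_max h1 orbT.
- by rewrite [zip _ _]/= total_length_cons s3/= addrC subrKA.
- rewrite [zip _ _]/= total_increment_cons s4 !variation_zip//= big_cons/=.
  by [].
Qed.

(** Induction on [L1]: the variation on its first interval is a supremum over
    partitions, and the intervals of a partition are moved to [L2], which keeps
    the total length. In the end only increments are left. *)
Lemma total_variation_sum_le a b f e d : 0 < e ->
  (forall L, nonoverlapping a b L ->
    total_length L < d -> total_increment f L < e) ->
  forall L1 L2, nonoverlapping a b (L1 ++ L2) -> total_length (L1 ++ L2) < d ->
  (\sum_(p <- L1) total_variation p.1 p.2 f + (total_increment f L2)%:E <= e%:E)%E.
Proof.
move=> e0 H; elim=> [|p L1 IH] L2.
  by rewrite big_nil add0e lee_fin => h1 h2; exact/ltW/H.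
rewrite cat_cons => /andP[/= /andP[/and3P[ap p12 pb] sub]].
rewrite -/(pairwise _ _) => /andP[pL dL] len.
have len' : total_length (L1 ++ L2) < d - (p.2 - p.1).
  by rewrite ltrBrDl -total_length_cons.
rewrite big_cons -addeA.
set X := (_ + (total_increment f L2)%:E)%E.
have X0 : (0 <= X)%E.
  rewrite /X adde_ge0 ?lee_fin ?/total_increment ?sumr_ge0//.
  rewrite big_seq sume_ge0// => q qL1; apply: total_variation_ge0.
  by move/allP : sub => /(_ q); rewrite mem_cat qL1 => /(_ isT) /and3P[].
have Xe : (X <= e%:E)%E.
  apply: IH; first by rewrite /nonoverlapping sub dL.
  by apply: (lt_le_trans len'); rewrite gerBl subr_ge0.
have Xf : X \is a fin_num.
  by rewrite ge0_fin_numE// (le_lt_trans Xe)// ltry.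
rewrite -leeBrDr//; apply: ge_ereal_sup => _ [_ [s ps <-] <-].
have [/andP[s1 s2] s3 s4] := itv_partition_nonoverlapping ps.
rewrite leeBrDr// addeC /X -addeA -EFinD [X in X%:E]addrC -s4.
rewrite -total_increment_cat.
apply: IH; last first.
  by move: len'; rewrite !total_length_cat s3; lra.
have Z q r : q \in zip (p.1 :: s) s -> r \in L1 ++ L2 -> disj_itv q r.
  move=> /(allP s1) /and3P[h1 _ h3] rL; apply: disj_itv_sub h1 h3 _.
  exact: (allP pL).
rewrite /nonoverlapping !all_cat; apply/andP; split.
  move: sub; rewrite all_cat => /andP[-> ->]; rewrite andbT/=.
  apply: sub_all s1 => q /and3P[h1 h2 h3].
  by rewrite /sub_itv h2 (le_trans ap h1) (le_trans h3 pb).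
move: dL; rewrite !pairwise_cat s2 => /and3P[d1 d2 d3]; rewrite d2 d3/= !andbT.
rewrite allrel_catr d1 andbT; apply/andP; split; apply/allrelP => q r q1 r1.
  by rewrite /disj_itv minC maxC; apply: Z; rewrite ?mem_cat ?q1.
by apply: Z; rewrite ?mem_cat ?r1 ?orbT.
Qed.

(** The variation is at most 1 on intervals of length at most [d / 2], and finitely
    many of them cover [[a, b]]. *)
Lemma ac_bounded_variation a b f : a <= b -> abs_continuous_on a b f ->
  bounded_variation a b f.
Proof.
move=> ab /ac_nonoverlapping/(_ 1 ltr01)[d d0 /(total_variation_sum_le ltr01) H].
have d20 : 0 < d / 2 by rewrite divr_gt0.
have small x y : a <= x -> x <= y -> y <= b -> y - x <= d / 2 ->
    (total_variation x y f <= 1)%E.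
  move=> ax xy yb yx; have := H [:: (x, y)] [::].
  rewrite /nonoverlapping/= /sub_itv/= ax xy yb/= /total_length.
  rewrite /total_increment !big_cons !big_nil !addr0 ?adde0/=; apply => //.
  by rewrite (le_lt_trans yx)// ltr_pdivrMr// ltr_pMr// ltr1n.
have K n x : a <= x -> x <= b -> x - a <= d / 2 *+ n ->
    (total_variation a x f <= n%:R%:E)%E.
  elim: n x => [x ax xb|n IH x ax xb xn].
    rewrite mulr0n subr_le0 => xa; have -> : x = a by apply/le_anti/andP.
    by rewrite total_variationxx.
  have [xd|xd] := leP (x - d / 2) a.
    rewrite (le_trans (small _ _ _ _ _ _))//; first by lra.
    by rewrite lee_fin ler1n.
  rewrite (@total_variationD _ _ _ (x - d / 2) f (ltW xd)); last by lra.
  rewrite -(natr1 n) EFinD; apply: leeD.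
    by apply: IH; [exact: ltW|lra|rewrite mulrSr in xn; lra].
  by apply: small; lra.
apply/bounded_variationP => //; rewrite ge0_fin_numE ?total_variation_ge0//.
have [n nd] : exists n, b - a <= d / 2 *+ n.
  exists (Num.bound ((b - a) / (d / 2))); rewrite -mulr_natr mulrC -ler_pdivrMr//.
  by rewrite ltW// archi_boundP// divr_ge0 ?subr_ge0// ltW.
by rewrite (le_lt_trans (K n b _ _ _))// ltry.
Qed.

Lemma ac_total_variation a b f : a <= b -> abs_continuous_on a b f ->
  abs_continuous_on a b (fun x => fine (total_variation a x f)).
Proof.
move=> ab ac e e0; have e20 : 0 < e / 2 by rewrite divr_gt0.
have bv := ac_bounded_variation ab ac.
have [d d0 /(total_variation_sum_le e20) H] := ac_nonoverlapping ac e20.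
exists d => // m u v uv tI len.
pose L := [seq (u i, v i) | i <- index_enum 'I_m].
have tvE i : `|fine (total_variation a (v i) f) - fine (total_variation a (u i) f)|%:E
    = total_variation (u i) (v i) f.
  have [au [ui vb]] := uv i; have av := le_trans au ui; have ub := le_trans ui vb.
  have fu : total_variation a (u i) f \is a fin_num.
    exact/(bounded_variationP _ au)/(bounded_variationl au ub).
  have fv : total_variation a (v i) f \is a fin_num.
    exact/(bounded_variationP _ av)/(bounded_variationl av vb).
  rewrite (total_variationD f au ui) in fv *.
  have fuv : total_variation (u i) (v i) f \is a fin_num.
    by move: fv; rewrite fin_numD => /andP[].
  rewrite fineD// addrAC subrr add0r ger0_norm ?fineK//.
  by rewrite fine_ge0// total_variation_ge0.
rewrite -lte_fin -sumEFin (eq_bigr _ (fun i _ => tvE i)).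
apply: (@le_lt_trans _ _ (e / 2)%:E); last first.
  by rewrite lte_fin ltr_pdivrMr// ltr_pMr// ltr1n.
have := H L [::]; rewrite cats0 /total_increment big_nil adde0.
rewrite /total_length /L !big_map; apply => //.
apply/andP; split.
  by apply/allP => _ /mapP[i _ ->]; rewrite /sub_itv/=; have [-> [-> ->]] := uv i.
rewrite pairwise_map; apply: (@sub_pairwise _ (fun i j : 'I_m => i != j)).
  move=> i j ij /=; apply/disj_itvP => /=; [by have [_ []] := uv i|by have [_ []] := uv j|].
  by move/trivIsetP : tI => /(_ i j I I ij).
by rewrite -uniq_pairwise index_enum_uniq.
Qed.

End TotalVariation.
(** * Density of a monotone absolutely continuous function *)

Section MonotoneDensity.
Context {R : realType}.
Notation mu := (@lebesgue_measure R).
Implicit Types (a b s : R) (f h phi : R -> R).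

Definition is_primitive a b phi f :=
  mu.-integrable `[a, b] (EFin \o phi) /\
  forall s, a <= s -> s <= b -> f s = f a + \int[mu]_(t in `[a, s]) phi t.

(** Composition with [clamp a b] extends a function on [[a, b]] to the line by
    constants, which preserves monotonicity and absolute continuity, as needed
    for a Stieltjes measure. *)
Definition clamp a b x : R := Num.max a (Num.min x b).

Lemma clamp_ge a b x : a <= clamp a b x.
Proof. by rewrite le_max lexx. Qed.

Lemma clamp_le a b x : a <= b -> clamp a b x <= b.
Proof. by move=> ab; rewrite ge_max ab ge_min lexx orbT. Qed.

Lemma clamp_id a b x : a <= x -> x <= b -> clamp a b x = x.
Proof. by move=> ax xb; rewrite /clamp (min_idPl xb) (max_idPr ax). Qed.

Lemma clamp_nd a b : {homo clamp a b : x y / x <= y}.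
Proof.
by move=> x y xy; rewrite /clamp ge_max !le_max lexx/= le_min !ge_min lexx xy !orbT.
Qed.

Lemma clampB a b x y : a <= b -> x <= y -> clamp a b y - clamp a b x <= y - x.
Proof.
move=> ab xy; rewrite /clamp; have [yb|yb] := leP y b; have [xb|xb] := leP x b.
all: by [have [ay|ay] := leP a y; have [ax|ax] := leP a x; lra|
         have [ay|ay] := leP a b; have [ax|ax] := leP a x; lra|
         have [ay|ay] := leP a y; have [ax|ax] := leP a b; lra|
         have [ay|ay] := leP a b; lra].
Qed.

Lemma clamp_itv_sub a b x y :
  `]clamp a b x, clamp a b y[%classic `<=` `]x, y[%classic.
Proof.
move=> z /=; rewrite !in_itv/= /clamp gt_max lt_max gt_min lt_min => /andP[].
move=> /andP[az /orP[-> /orP[|/andP[->]]|bz /orP[|/andP[_]]]] // za.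
- by have := lt_trans az za; rewrite ltxx.
- by have := lt_trans az za; rewrite ltxx.
- by have := lt_trans bz za; rewrite ltxx.
Qed.

Lemma ac_clamp a b f : a <= b -> abs_continuous_on a b f ->
  forall e, 0 < e -> exists2 d, 0 < d & forall m (u v : 'I_m -> R),
    (forall i, u i <= v i) -> trivIset setT (fun i => `]u i, v i[%classic) ->
    \sum_(i < m) (v i - u i) < d ->
    \sum_(i < m) `|f (clamp a b (v i)) - f (clamp a b (u i))| < e.
Proof.
move=> ab ac e /ac[d d0 H]; exists d => // m u v uv tI len.
apply: (H m (fun i => clamp a b (u i)) (fun i => clamp a b (v i))).
- by move=> i; rewrite clamp_ge clamp_nd// clamp_le.
- apply/trivIsetP => i j _ _ ij; move/trivIsetP : tI => /(_ i j I I ij).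
  rewrite -!subset0 => uv0; apply: subset_trans uv0.
  by apply: setISS; exact: clamp_itv_sub.
- by apply: le_lt_trans len; apply: ler_sum => i _; exact: clampB.
Qed.

Lemma ac_clamp1 a b f : a <= b -> abs_continuous_on a b f ->
  forall e, 0 < e -> exists2 d, 0 < d & forall x y, `|x - y| < d ->
    `|f (clamp a b x) - f (clamp a b y)| < e.
Proof.
move=> ab ac e /(ac_clamp ab ac)[d d0 H]; exists d => // x y.
wlog xy : x y / x <= y => [W|].
  have [/W|/ltW/W yx] := leP x y; first exact.
  by rewrite distrC (distrC (f _)).
rewrite distrC ger0_norm ?subr_ge0// => xyd; rewrite distrC.
have := H 1%N (fun=> x) (fun=> y); rewrite !big_ord1; apply => //.
by apply/trivIsetP => i j _ _; rewrite !ord1 eqxx.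
Qed.

Lemma open_itv_finite (I : set R) : open I -> is_interval I ->
  (mu I < +oo)%E -> exists c d, c <= d /\ I = `]c, d[%classic.
Proof.
move=> oI iI; have IE := RhullK (mem_set iI).
have [->|/set0P[x Ix]] := eqVneq I set0.
  by move=> _; exists 0, 0; rewrite set_itvoo0.
rewrite -[in mu _]IE lebesgue_measure_itv /Rhull /=.
have [lI|lI] := asboolP (has_lbound I);
  have [uI|uI] := asboolP (has_ubound I) => /=.
2-4: by rewrite ?ltNyr ?ltry ?ltNyy//= ?ltry ?ltxx.
move=> _.
exists (inf I), (sup I); split; last first.
  by rewrite -(interval_bounded_interior iI lI uI) ((interior_id _).1 oI).
by apply: (@le_trans _ _ x); [exact: ge_inf|exact: ub_le_sup].
Qed.

Lemma stieltjes_oc (h : cumulative R R) c d : c <= d ->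
  lebesgue_stieltjes_measure h `]c, d] = (h d - h c)%:E.
Proof.
move=> cd; rewrite /lebesgue_stieltjes_measure /measure_extension.
by rewrite measurable_mu_extE/= ?wlength_itv_bnd//; exact: is_ocitv.
Qed.

(** Lebesgue-null sets are covered by an open set of small measure, a countable
    disjoint union of intervals; absolute continuity bounds the Stieltjes
    measure of every finite subunion. *)
Lemma stieltjes_dominated a b f (h : cumulative R R) : a <= b ->
  abs_continuous_on a b f -> (forall x, h x = f (clamp a b x)) ->
  lebesgue_stieltjes_measure h `<< mu.
Proof.
move=> ab ac hE N nullN A mA AN.
have muA : mu A = 0%E by exact: nullN.
apply/eqP; rewrite eq_le measure_ge0 andbT.
apply/lee_addgt0Pr => e e0; rewrite add0e.
have [d d0 H] := ac_clamp ab ac e0.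
have [U [oU AU UA]] := lebesgue_regularity_outer mA
  (eq_ind_r (fun x => x < +oo)%E (ltry 0) muA) d0.
have mU : measurable U by exact: open_measurable.
have muU : (mu U < d%:E)%E.
  rewrite -(setDUK AU) (le_lt_trans (measureU2 _ mA _))//.
    exact: measurableD.
  by rewrite [X in (X + _)%E]muA add0e.
apply: (@le_trans _ _ (lebesgue_stieltjes_measure h U)).
  by apply: le_measure; rewrite ?inE.
pose I := open_disjoint_itv oU.
have UE : U = \bigcup_q I q by exact: open_disjoint_itv_bigcup.
have tI : trivIset setT I by exact: open_disjoint_itv_trivIset.
have mI i : measurable (I i).
  by apply: open_measurable; exact: open_disjoint_itv_open.
have IU i : I i `<=` U by rewrite UE; exact: bigcup_sup.
have /choice[c /choice[e' cd]] : forall i, exists c d, c <= d /\ I i = `]c, d[%classic.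
  move=> i; apply: open_itv_finite; [exact: open_disjoint_itv_open|
    exact: open_disjoint_itv_is_interval|].
  apply: (@le_lt_trans _ _ (mu U)); last by rewrite (lt_trans muU)// ltry.
  by apply: le_measure; rewrite ?inE; [exact: mI|exact: mU|exact: IU].
have hI i : (lebesgue_stieltjes_measure h (I i) <= `|h (e' i) - h (c i)|%:E)%E.
  have [ci ->] := cd i.
  apply: (@le_trans _ _ (lebesgue_stieltjes_measure h `]c i, e' i])).
    by apply: le_measure; rewrite ?inE//; exact: subset_itv_oo_oc.
  by rewrite stieltjes_oc// lee_fin ler_norm.
rewrite UE measure_bigcup//; last by move=> i _; exact: mI.
apply: lime_le; first exact: is_cvg_nneseries.
apply: nearW => n; rewrite big_mkord.
apply: (@le_trans _ _ (\sum_(i < n) `|h (e' i) - h (c i)|%:E)%E).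
  rewrite big_mkcond/=; apply: lee_sum => i _; case: ifPn => [_|].
    exact: hI.
  by rewrite in_setT.
rewrite sumEFin lee_fin ltW//; under eq_bigr do rewrite !hE.
apply: (H n (fun i => c i) (fun i => e' i)).
- by move=> i; have [] := cd i.
- apply/trivIsetP => i j _ _ ij; have [_ <-] := cd i; have [_ <-] := cd j.
  by move/trivIsetP : tI; apply.
- rewrite -lte_fin -sumEFin; apply: le_lt_trans muU.
  rewrite (eq_bigr (fun i : 'I_n => mu (I i))); last first.
    move=> i _; have [ci ->] := cd i.
    rewrite lebesgue_measure_itv/= lte_fin; case: ltP => // h'.
    by rewrite (@le_anti _ _ (c i) (e' i)) ?ci// subrr.
  rewrite -(@measure_bigsetU_ord _ _ _ mu n xpredT (fun i => I i)); [|by move=> i; exact: mI|].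
    apply: le_measure; rewrite ?inE; [|exact: mU|].
      by apply: bigsetU_measurable => i _; exact: mI.
    by rewrite -bigcup_mkord => x [i _ /IU].
  apply/trivIsetP => i j _ _ ij.
  by move/trivIsetP : tI; apply.
Qed.

(** The density is the Radon-Nikodym derivative of the Stieltjes measure,
    restricted to [[a, b]] to make it finite. *)
Lemma monotone_ac_density a b f : a < b -> abs_continuous_on a b f ->
  {in `[a, b] &, nondecreasing_fun f} -> exists phi, is_primitive a b phi f.
Proof.
move=> ab ac nd; have leab := ltW ab.
pose h0 x := f (clamp a b x).
have hnd : nondecreasing h0.
  by move=> x y xy; apply: nd; rewrite ?in_itv/= ?clamp_ge ?clamp_le ?clamp_nd.
have hrc : right_continuous h0.
  move=> x; apply: cvg_within_filter; apply/cvgrPdist_lt => e e0.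
  have [d d0 H] := ac_clamp1 leab ac e0.
  by exists d => // y /=; exact: H.
pose h : cumulative R R := HB.pack_for (cumulative R R) h0 (isCumulative.Build R _ R h0 hnd hrc).
have hE x : h x = f (clamp a b x) by [].
have dom := stieltjes_dominated leab ac hE.
pose nu0 := lebesgue_stieltjes_measure h.
have mab : measurable (`]a, b]%classic : set (measurableTypeR R)).
  exact: measurable_itv.
have fin : (nu0 `]a, b]%classic < +oo)%E by rewrite /nu0 stieltjes_oc// ltry.
pose nu : {finite_measure set (measurableTypeR R) -> \bar R} := mfrestr mab fin.
have dom' : nu `<< mu.
  move=> N nullN A mA AN; rewrite /nu/= /mfrestr /mrestr.
  apply: (dom _ nullN); first exact: measurableI.
  by move=> x [/AN].
have [g [g0 gfin gint gE]] := radon_nikodym_sigma_finite dom'.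
exists (fine \o g).
have gE' : EFin \o (fine \o g) = g by apply/funext => x /=; rewrite fineK.
split; first by rewrite gE'; apply: integrableS gint.
move=> s as_ sb; apply/eqP; rewrite addrC -subr_eq; apply/eqP.
rewrite -Rintegral_itv_obnd_cbnd; last by rewrite gE'; exact: integrableS gint.
rewrite /Rintegral (eq_integral g); last by move=> x _ /=; rewrite fineK.
rewrite -gE//= /mfrestr /mrestr setIidl; last first.
  by apply: subset_itvl; rewrite bnd_simp.
by rewrite /nu0 stieltjes_oc//= /h0 !clamp_id// ltW.
Qed.

End MonotoneDensity.
(** * Calculus of derivatives within an interval *)

Section Slopes.
Context {R : realType} {V : normedModType R}.
Implicit Types (a b s t e d : R) (f g : R -> V) (l : V).

Definition has_derive_on a b f s l :=
  slope_on f s t @[t --> within `[a, b] s^'] --> l.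

(** The increment form of the derivative; unlike difference quotients it also
    makes sense at [t = s]. *)
Lemma has_derive_onP a b f s l : has_derive_on a b f s l <->
  forall e, 0 < e -> exists2 d, 0 < d & forall t, t \in `[a, b] ->
    `|t - s| < d -> `|f t - f s - (t - s) *: l| <= e * `|t - s|.
Proof.
have E t : t != s -> `|l - slope_on f s t| * `|t - s| = `|f t - f s - (t - s) *: l|.
  move=> ts; rewrite mulrC -normrZ /slope_on scalerBr scalerA divff ?subr_eq0//.
  by rewrite scale1r distrC.
split=> [/cvgrPdist_le H e e0|H].
  have [d /= d0 dH] := H _ e0.
  exists d => // t tab ts; have [->|nts] := eqVneq t s.
    by rewrite !subrr scale0r subr0 !normr0 mulr0.
  rewrite -E// ler_wpM2r//; apply: dH => //=.
  by rewrite distrC.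
apply/cvgrPdist_le => e e0; have [d d0 dH] := H e e0.
exists d => //= t /=; rewrite distrC => ts nts tab.
rewrite -(@ler_pM2r _ `|t - s|) ?normr_gt0 ?subr_eq0//.
by rewrite E//; exact: dH.
Qed.

Lemma within_dnbhs_proper a b s : a < b -> s \in `[a, b] ->
  ProperFilter (within `[a, b] s^').
Proof.
move=> ab; rewrite in_itv/= => /andP[as_ sb].
apply: Build_ProperFilter_ex.
move=> A [d /= d0 H].
have [sb'|bs] := ltP s b.
  exists (Num.min b (s + d / 2)); apply: H => /=.
  - rewrite distrC ger0_norm; last by rewrite subr_ge0 le_min sb/=; lra.
    by rewrite ltrBlDl gt_min; apply/orP; right; lra.
  - by rewrite gt_eqF// lt_min sb'/=; lra.
  - by rewrite in_itv/= ge_min lexx andbT le_min (ltW ab)/=; lra.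
have sE : s = b by apply/le_anti/andP.
exists (Num.max a (s - d / 2)); apply: H => /=.
- rewrite ger0_norm; last by rewrite subr_ge0 ge_max as_/=; lra.
  by rewrite ltrBlDl -ltrBlDr lt_max; apply/orP; right; lra.
- by rewrite lt_eqF// gt_max {1}sE ab/=; lra.
- by rewrite in_itv/= le_max lexx ge_max (ltW ab)/=; lra.
Qed.

Lemma has_derive_on_unique a b f s l l' : a < b -> s \in `[a, b] ->
  has_derive_on a b f s l -> has_derive_on a b f s l' -> l = l'.
Proof.
move=> ab sab h h'; have F := within_dnbhs_proper ab sab.
by apply: (cvg_unique _ h h'); exact: norm_hausdorff.
Qed.

Lemma has_derive_onE a b f s l : a < b -> s \in `[a, b] ->
  has_derive_on a b f s l -> derivable_on a b f s /\ derive_on a b f s = l.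
Proof.
move=> ab sab h; have F := within_dnbhs_proper ab sab.
split; first by apply/cvg_ex; exists l.
by apply: cvg_lim => //; exact: norm_hausdorff.
Qed.

Lemma eq_has_derive_on a b f g s l : s \in `[a, b] ->
  (forall t, t \in `[a, b] -> f t = g t) ->
  has_derive_on a b f s l -> has_derive_on a b g s l.
Proof.
move=> sab fg /has_derive_onP H; apply/has_derive_onP => e /H[d d0 dH].
by exists d => // t tab ts; rewrite -!fg//; exact: dH.
Qed.

Lemma has_derive_on_lip a b f s l : has_derive_on a b f s l ->
  exists2 d, 0 < d & forall t, t \in `[a, b] -> `|t - s| < d ->
    `|f t - f s| <= (`|l| + 1) * `|t - s|.
Proof.
move=> /has_derive_onP /(_ 1 ltr01)[d d0 H]; exists d => // t tab ts.
have := H t tab ts; rewrite mul1r => {}H.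
rewrite -(subrK ((t - s) *: l) (f t - f s)) (le_trans (ler_normD _ _))//.
by rewrite normrZ mulrDl mul1r addrC mulrC lerD2l.
Qed.

Lemma has_derive_on_continuous a b f s l : has_derive_on a b f s l ->
  f t @[t --> within `[a, b] (nbhs s)] --> f s.
Proof.
move=> /has_derive_on_lip[d d0 H]; apply/cvgrPdist_le => e e0.
have M0 : 0 < `|l| + 1 by rewrite ltr_wpDl.
exists (Num.min d (e / (`|l| + 1))) => /=; first by rewrite lt_min d0 divr_gt0.
move=> t /=; rewrite distrC lt_min => /andP[td te] tab.
rewrite distrC (le_trans (H t tab td))// mulrC -ler_pdivlMr//.
exact: ltW.
Qed.

Lemma has_derive_on_cvg a b f s l : has_derive_on a b f s l ->
  f t @[t --> within `[a, b] s^'] --> f s.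
Proof.
move=> /has_derive_on_continuous; apply: cvg_trans.
by apply: cvg_app => A [d d0 H]; exists d => // t ts _; exact: H.
Qed.

End Slopes.

Section RealSlopes.
Context {R : realType}.
Implicit Types (a b s t : R) (f g : R -> R).

Lemma has_derive_on_cst a b (c : R) s : has_derive_on a b (fun=> c) s (0 : R).
Proof.
apply/has_derive_onP => e e0; exists 1 => // t _ _.
by rewrite scaler0 !subrr normr0 mulr_ge0// ltW.
Qed.

Lemma has_derive_onD a b f g s l l' : has_derive_on a b f s l ->
  has_derive_on a b g s l' -> has_derive_on a b (fun t => f t + g t) s (l + l').
Proof.
move=> h h'; rewrite /has_derive_on.
have -> : slope_on (fun t => f t + g t) s = fun t => slope_on f s t + slope_on g s t.
  by apply/funext => t; rewrite /slope_on -scalerDr; congr (_ *: _); ring.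
exact: cvgD.
Qed.

Lemma has_derive_onM a b f g s l l' : has_derive_on a b f s l ->
  has_derive_on a b g s l' ->
  has_derive_on a b (fun t => f t * g t) s (l * g s + f s * l').
Proof.
move=> h h'; rewrite /has_derive_on.
have -> : slope_on (fun t => f t * g t) s =
    fun t => slope_on f s t * g s + f t * slope_on g s t.
  by apply/funext => t; rewrite /slope_on /GRing.scale/=; ring.
apply: cvgD; first by apply: cvgM => //; exact: cvg_cst.
by apply: cvgM => //; exact: has_derive_on_cvg h.
Qed.

Lemma has_derive_on_sum (I : Type) (r : seq I) a b (F : I -> R -> R) s (l : I -> R) :
  (forall i, has_derive_on a b (F i) s (l i)) ->
  has_derive_on a b (fun t => \sum_(i <- r) F i t) s (\sum_(i <- r) l i).
Proof.
move=> H; elim: r => [|i r IH].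
  rewrite big_nil; under eq_fun do rewrite big_nil; exact: has_derive_on_cst.
by rewrite big_cons; under eq_fun do rewrite big_cons; exact: has_derive_onD.
Qed.

(** Caratheodory's factorization of the increment of [F] spares the case
    distinction on [f t = f s]. *)
Lemma has_derive_on_comp a b (F : R -> R) f s l l' :
  is_derive (f s) (1 : R) F l' -> has_derive_on a b f s l ->
  has_derive_on a b (fun t => F (f t)) s (l' * l).
Proof.
move=> /is_derive1_caratheodory[g [Fg cg <-]] h; rewrite /has_derive_on.
have -> : slope_on (fun t => F (f t)) s = fun t => g (f t) * slope_on f s t.
  by apply/funext => t; rewrite /slope_on /GRing.scale/= Fg; ring.
apply: cvgM => //; apply: continuous_cvg; first exact: cg.
exact: has_derive_on_cvg h.
Qed.

End RealSlopes.

Section MatrixSlopes.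
Context {R : realType} (m n : nat).
Implicit Types (a b s t : R) (f : R -> 'M[R]_(m, n)).

Lemma mx_norm_entry_le (A : 'M[R]_(m, n)) i j : `|A i j| <= `|A|.
Proof.
rewrite [leRHS]/Num.Def.normr/= mx_normrE.
by apply: le_bigmax (fun ij : 'I_m * 'I_n => `|A ij.1 ij.2|) (i, j).
Qed.

Lemma mx_norm_le (A : 'M[R]_(m, n)) (e : R) : 0 <= e ->
  (forall i j, `|A i j| <= e) -> `|A| <= e.
Proof.
move=> e0 H; rewrite [leLHS]/Num.Def.normr/= mx_normrE.
by apply: bigmax_le => // -[i j] _; exact: H.
Qed.

Lemma has_derive_on_mxP a b f s l : has_derive_on a b f s l <->
  forall i j, has_derive_on a b (fun t => f t i j) s (l i j).
Proof.
split=> [/has_derive_onP H i j|H].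
  apply/has_derive_onP => e /H[d d0 dH]; exists d => // t tab ts.
  by apply: le_trans (dH t tab ts); have := mx_norm_entry_le (f t - f s - (t - s) *: l) i j; rewrite !mxE.
apply/has_derive_onP => e e0.
have /choice[D DH] : forall ij : 'I_m * 'I_n, exists d, 0 < d /\ forall t,
    t \in `[a, b] -> `|t - s| < d ->
    `|f t ij.1 ij.2 - f s ij.1 ij.2 - (t - s) *: l ij.1 ij.2| <= e * `|t - s|.
  move=> [i j]; have /has_derive_onP /(_ e e0)[d d0 dH] := H i j.
  by exists d.
exists (\big[Num.min/1]_ij D ij).
  by apply: lt_bigmin => // ij _; have [] := DH ij.
move=> t tab ts; apply: mx_norm_le => [|i j]; first by rewrite mulr_ge0// ltW.
have [_ /(_ t tab)] := DH (i, j); rewrite !mxE; apply.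
by rewrite (lt_le_trans ts)//; exact: bigmin_le.
Qed.

End MatrixSlopes.

Lemma has_derive_on_mulmx {R : realType} (m n p : nat) (a b s : R)
    (f : R -> 'M[R]_(m, n)) (g : R -> 'M[R]_(n, p)) l l' :
  has_derive_on a b f s l -> has_derive_on a b g s l' ->
  has_derive_on a b (fun t => f t *m g t) s (l *m g s + f s *m l').
Proof.
move=> /has_derive_on_mxP Df /has_derive_on_mxP Dg; apply/has_derive_on_mxP => i j.
have := has_derive_on_sum (r := index_enum _)
  (fun k : 'I_n => has_derive_onM (Df i k) (Dg k j)).
rewrite mxE [X in X + _]mxE [X in _ + X]mxE -big_split.
by congr has_derive_on; apply/funext => t; rewrite mxE.
Qed.
(** * Absolutely continuous functions are the primitives of integrable ones *)

Section AbsolutelyContinuous.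
Context {R : realType}.
Implicit Types (a b s t : R).

(** Sums, products, coordinates and Lipschitz images of absolutely continuous
    functions all satisfy such an estimate of increments. *)
Lemma ac_dominated (U V W : normedModType R) a b (f : R -> U) (g : R -> V)
    (h : R -> W) (C : R) :
  (forall u v, u \in `[a, b] -> v \in `[a, b] ->
    `|h v - h u| <= C * (`|f v - f u| + `|g v - g u|)) ->
  abs_continuous_on a b f -> abs_continuous_on a b g -> abs_continuous_on a b h.
Proof.
move=> H acf acg e e0.
pose C' := `|C| + 1; have C0 : 0 < C' by rewrite ltr_wpDl.
have e20 : 0 < e / 2 / C' by rewrite !divr_gt0.
have [d1 d10 H1] := acf _ e20; have [d2 d20 H2] := acg _ e20.
exists (Num.min d1 d2); first by rewrite lt_min d10.
move=> m u v uv tI; rewrite lt_min => /andP[l1 l2].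
have := ltrD (H1 m u v uv tI l1) (H2 m u v uv tI l2).
rewrite -big_split/= -mulrDl -splitr ltr_pdivlMr//; apply: le_lt_trans.
rewrite mulr_suml; apply: ler_sum => i _; have [au [ui vb]] := uv i.
rewrite mulrC (le_trans (H _ _ _ _))//.
- by rewrite in_itv/= au (le_trans ui).
- by rewrite in_itv/= vb (le_trans au).
- by rewrite ler_wpM2r ?addr_ge0// /C' (le_trans (ler_norm C))// lerDl.
Qed.

Lemma ac_mxP (m n : nat) a b (g : R -> 'M[R]_(m, n)) :
  abs_continuous_on a b g <-> forall i j, abs_continuous_on a b (fun s => g s i j).
Proof.
split=> [H i j|H].
  apply: (ac_dominated (C := 1) _ H H) => u v _ _; rewrite mul1r.
  have := mx_norm_entry_le (g v - g u) i j; rewrite !mxE => /le_trans; apply.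
  by rewrite lerDl.
move=> e e0.
have n0 : 0 < (#|{: 'I_m * 'I_n}|.+1)%:R :> R by rewrite ltr0n.
have /choice[D DH] : forall ij : 'I_m * 'I_n, exists d, 0 < d /\
    forall k (u v : 'I_k -> R), (forall i, a <= u i /\ u i <= v i /\ v i <= b) ->
      trivIset setT (fun i => `]u i, v i[%classic) ->
      \sum_(i < k) (v i - u i) < d ->
      \sum_(i < k) `|g (v i) ij.1 ij.2 - g (u i) ij.1 ij.2| < e / (#|{: 'I_m * 'I_n}|.+1)%:R.
  by move=> [i j]; have [d d0 Hd] := H i j _ (divr_gt0 e0 n0); exists d.
exists (\big[Num.min/1]_ij D ij).
  by apply: lt_bigmin => // ij _; have [] := DH ij.
move=> k u v uv tI len.
apply: (@le_lt_trans _ _ (\sum_(i < k) \sum_(ij : 'I_m * 'I_n)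
    `|g (v i) ij.1 ij.2 - g (u i) ij.1 ij.2|)).
  apply: ler_sum => i _; apply: mx_norm_le => [|p q]; first exact: sumr_ge0.
  rewrite !mxE (bigD1 (p, q))//= lerDl; exact: sumr_ge0.
rewrite exchange_big/=.
apply: (@le_lt_trans _ _ (\sum_(ij : 'I_m * 'I_n) e / (#|{: 'I_m * 'I_n}|.+1)%:R)).
  apply: ler_sum => ij _; have [_ /(_ k u v uv tI)] := DH ij => Hij.
  by apply/ltW/Hij; rewrite (lt_le_trans len)//; exact: bigmin_le.
rewrite sumr_const -[X in X < _]mulr_natr mulrAC -mulrA gtr_pMr//.
by rewrite ltr_pdivrMr// mul1r ltr_nat.
Qed.

End AbsolutelyContinuous.

Section Primitives.
Context {R : realType}.
Notation mu := (@lebesgue_measure R).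
Implicit Types (a b s t u v : R) (f g phi psi : R -> R).

Lemma itv_sub a b u v : a <= u -> v <= b -> `[u, v]%classic `<=` `[a, b]%classic.
Proof. by move=> au vb; apply: subset_itv; rewrite bnd_simp. Qed.

Lemma integrable_sub a b u v phi : a <= u -> v <= b ->
  mu.-integrable `[a, b] (EFin \o phi) -> mu.-integrable `[u, v] (EFin \o phi).
Proof. by move=> au vb; apply: integrableS => //; exact: itv_sub. Qed.

Lemma is_primitive_itv a b phi f u v : is_primitive a b phi f ->
  a <= u -> u <= v -> v <= b -> f v - f u = \int[mu]_(t in `[u, v]) phi t.
Proof.
move=> [ip H] au uv vb; have [av ub] := (le_trans au uv, le_trans uv vb).
rewrite (H v av vb) (H u au ub).
have iv : mu.-integrable `[a, v] (EFin \o phi) by exact: integrable_sub ip.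
rewrite opprD addrACA subrr add0r Rintegral_itvB//.
by rewrite Rintegral_itv_obnd_cbnd//; apply: integrableS iv => //; apply: subset_itvr.
Qed.

Lemma is_primitive_integral a b phi c : mu.-integrable `[a, b] (EFin \o phi) ->
  is_primitive a b phi (fun s => c + \int[mu]_(t in `[a, s]) phi t).
Proof.
move=> ip; split=> // s as_ sb.
by rewrite set_itv1 Rintegral_set1 addr0.
Qed.

Lemma eq_is_primitive a b phi f g : (forall s, s \in `[a, b] -> f s = g s) ->
  is_primitive a b phi f -> is_primitive a b phi g.
Proof.
move=> fg [ip H]; split=> // s as_ sb.
by rewrite -!fg ?in_itv/= ?as_ ?lexx ?(le_trans as_ sb)//; exact: H.
Qed.

Lemma is_primitive_ae a b phi psi f : measurable_fun `[a, b] psi ->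
  ae_eq mu `[a, b]%classic phi psi -> is_primitive a b phi f -> is_primitive a b psi f.
Proof.
move=> mpsi ae [ip H].
have mphi : measurable_fun `[a, b] phi.
  by apply/measurable_EFinP; exact: (measurable_int mu).
have aeE : ae_eq mu `[a, b]%classic (EFin \o phi) (EFin \o psi).
  by apply: filterS ae => x /[apply] /= ->.
split.
  apply/integrableP; split; first exact/measurable_EFinP.
  rewrite (@ae_eq_integral _ _ _ mu _ (fun x => `|(phi x)%:E|)%E (fun x => `|(psi x)%:E|)%E)//.
  - by have /integrableP[] := ip.
  - by do 2 apply: measurableT_comp => //; exact/measurable_EFinP.
  - by do 2 apply: measurableT_comp => //; exact/measurable_EFinP.
  - by apply: filterS ae => x /[apply] /= ->.
move=> s as_ sb; rewrite (H s as_ sb); congr (_ + fine _).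
have sub : `[a, s]%classic `<=` `[a, b]%classic by exact: itv_sub.
apply: ae_eq_integral => //.
- by apply/measurable_EFinP; exact: measurable_funS mphi.
- by apply/measurable_EFinP; exact: measurable_funS mpsi.
- by apply: filterS ae => x H' /sub /H' /= ->.
Qed.

Lemma is_primitiveB a b phi psi f g : is_primitive a b phi f ->
  is_primitive a b psi g ->
  is_primitive a b (fun t => phi t - psi t) (fun t => f t - g t).
Proof.
move=> [ip Hf] [iq Hg]; split; first exact: (integrableB _ ip iq).
move=> s as_ sb; rewrite (Hf s as_ sb) (Hg s as_ sb) RintegralB//; first by ring.
  exact: integrable_sub ip.
exact: integrable_sub iq.
Qed.

(** [A] is the union of the open intervals. *)
Lemma integral_disjoint_itv a b phi m (u v : 'I_m -> R) :
  mu.-integrable `[a, b] (EFin \o phi) ->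
  (forall i, a <= u i /\ u i <= v i /\ v i <= b) ->
  trivIset setT (fun i => `]u i, v i[%classic) ->
  exists A : set R, [/\ measurable A, A `<=` `[a, b]%classic,
    mu A = (\sum_(i < m) (v i - u i))%:E &
    \sum_(i < m) \int[mu]_(t in `[u i, v i]) phi t = \int[mu]_(t in A) phi t].
Proof.
move=> ip uv tI.
pose F (i : 'I_m) : set R := `]u i, v i[%classic.
have mF i : measurable (F i) by exact: measurable_itv.
pose A : set R := \big[setU/set0]_(i < m) F i.
have mA : measurable A by apply: bigsetU_measurable => i _; exact: mF.
have Fab i : F i `<=` `[a, b]%classic.
  have [au [_ vb]] := uv i; move=> x /= /subset_itv_oo_cc; exact: itv_sub.
have Aab : A `<=` `[a, b]%classic.
  by rewrite /A -bigcup_seq => x [i _ /Fab].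
have iF i : mu.-integrable `]u i, v i[ (EFin \o phi).
  by apply: integrableS ip => //; exact: Fab.
exists A; split => //.
  rewrite (@measure_bigsetU_ord _ _ _ mu m xpredT F)//.
  rewrite (eq_bigr (fun i => (v i - u i)%:E)); first by rewrite sumEFin.
  move=> i _; rewrite -[LHS]/(lebesgue_measure (`]u i, v i[%classic : set R)).
  rewrite lebesgue_measure_itv/= lte_fin; case: ltP => // h'.
  by have [_ [ui _]] := uv i; rewrite (@le_anti _ _ (u i) (v i)) ?ui// subrr.
apply: EFin_inj; rewrite -sumEFin [in RHS]/Rintegral fineK; last first.
  by apply: integrable_fin_num => //; exact: integrableS ip.
rewrite (integral_bigsetU_EFin mu mF (index_enum_uniq _)) //; last 2 first.
- apply/trivIsetP => i j _ _ ij; move/trivIsetP : tI; exact.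
- by apply: (measurable_int mu); exact: integrableS ip.
apply: eq_bigr => i _; have [au [ui vb]] := uv i.
rewrite -Rintegral_itv_obnd_cbnd; last first.
  by apply: integrableS (integrable_sub au vb ip) => //; exact: subset_itv_oc_cc.
rewrite -(@Rintegral_itv_bndo_bndc _ (BRight (u i)) (v i) phi (iF i)).
by rewrite /Rintegral fineK//; apply: integrable_fin_num => //; exact: iF.
Qed.

(** Absolute continuity of the integral of [|phi|] with respect to the measure. *)
Lemma is_primitive_ac a b phi f : is_primitive a b phi f -> abs_continuous_on a b f.
Proof.
move=> pf; have [ip _] := pf.
have ipT : mu.-integrable setT (EFin \o (phi \_ `[a, b])).
  by rewrite -restrict_EFin; apply/(integrable_mkcond _ _).1.
have inp : mu.-integrable `[a, b] (EFin \o (fun x => `|phi x|)).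
  exact: integrable_norm.
move=> e e0; have [d [d0 H]] := integral_normr_continuous ipT e0.
exists d => // m u v uv tI len.
have [A [mA Aab muA sumA]] := integral_disjoint_itv inp uv tI.
apply: le_lt_trans (H A mA _); last by rewrite [X in (X < _)%E]muA lte_fin.
apply: (@le_trans _ _ (\int[mu]_(x in A) `|phi x|)).
  rewrite -sumA; apply: ler_sum => i _; have [au [ui vb]] := uv i.
  rewrite (is_primitive_itv pf)//; apply: le_normr_Rintegral => //.
  exact: integrable_sub ip.
rewrite le_eqVlt; apply/orP; left; apply/eqP/eq_Rintegral => x.
by rewrite inE => /Aab xab; rewrite patchE mem_set.
Qed.

End Primitives.
(** * The fundamental theorem of calculus for absolutely continuous functions *)

Section FundamentalTheorem.
Context {R : realType}.
Notation mu := (@lebesgue_measure R).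
Implicit Types (a b s t u v : R) (f g phi psi : R -> R).

Lemma ae_imply (P Q : R -> Prop) : (forall x, P x -> Q x) ->
  {ae mu, forall x, P x} -> {ae mu, forall x, Q x}.
Proof. by move=> PQ; apply: (@filterS _ _ (ae_filter_ringOfSetsType mu)). Qed.

Lemma ae_imply2 (P Q S : R -> Prop) : (forall x, P x -> Q x -> S x) ->
  {ae mu, forall x, P x} -> {ae mu, forall x, Q x} -> {ae mu, forall x, S x}.
Proof. by move=> PQ; apply: (@filterS2 _ _ (ae_filter_ringOfSetsType mu)). Qed.

Lemma ae_forall (I : finType) (P : I -> R -> Prop) :
  (forall i, {ae mu, forall x, P i x}) -> {ae mu, forall x, forall i, P i x}.
Proof.
move=> H; apply: (@ae_imply (fun x => forall i, i \in enum I -> P i x)).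
  by move=> x Hx i; apply: Hx; rewrite mem_enum.
elim: (enum I) => [|i s IH]; first by apply: (@aeW _ _ _ mu) => x i.
apply: ae_imply2 (H i) IH => x Px Hx j.
by rewrite inE => /predU1P[->//|]; exact: Hx.
Qed.

Lemma ac_continuous (V : normedModType R) a b (f : R -> V) : abs_continuous_on a b f ->
  {within `[a, b], continuous f}.
Proof.
move=> ac; apply/subspace_continuousP => x xab.
apply/cvgrPdist_le => e /ac[d d0 H]; exists d => // y /= xy yab.
have H1 u v : u \in `[a, b] -> v \in `[a, b] -> u <= v -> v - u < d -> `|f v - f u| <= e.
  rewrite !in_itv/= => /andP[au ub] /andP[av vb] uv lt.
  have := H 1%N (fun=> u) (fun=> v); rewrite !big_ord1 => H'; apply/ltW/H' => //.
  by apply/trivIsetP => i j _ _; rewrite !ord1 eqxx.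
have [le|le] := leP x y; move: xy.
  by rewrite distrC ger0_norm ?subr_ge0// => xy; rewrite distrC; exact: (H1 x y xab yab le xy).
rewrite ger0_norm ?subr_ge0 ?(ltW le)// => xy; exact: (H1 y x yab xab (ltW le) xy).
Qed.

Lemma eq_within_continuous a b f g : (forall s, s \in `[a, b] -> f s = g s) ->
  {within `[a, b], continuous f} -> {within `[a, b], continuous g}.
Proof.
move=> fg; apply: subspace_eq_continuous => s sab; apply: fg.
by rewrite inE in sab.
Qed.

Lemma within_continuousM a b f g : {within `[a, b], continuous f} ->
  {within `[a, b], continuous g} -> {within `[a, b], continuous (fun s => f s * g s)}.
Proof.
move=> /subspace_continuousP cf /subspace_continuousP cg.
by apply/subspace_continuousP => x xab; apply: cvgM; [exact: cf|exact: cg].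
Qed.

Lemma within_continuous_norm a b f : {within `[a, b], continuous f} ->
  {within `[a, b], continuous (fun s => `|f s|)}.
Proof.
move=> /subspace_continuousP cf.
by apply/subspace_continuousP => x xab; apply: cvg_norm; exact: cf.
Qed.

Lemma within_continuousD a b f g : {within `[a, b], continuous f} ->
  {within `[a, b], continuous g} -> {within `[a, b], continuous (fun s => f s + g s)}.
Proof.
move=> /subspace_continuousP cf /subspace_continuousP cg.
by apply/subspace_continuousP => x xab; apply: cvgD; [exact: cf|exact: cg].
Qed.

Lemma within_continuous_cst a b (c : R) : {within `[a, b], continuous (fun=> c)}.
Proof. by apply: continuous_subspaceT => x; exact: cvg_cst. Qed.

Lemma within_continuous_sum (I : Type) (r : seq I) a b (F : I -> R -> R) :
  (forall i, {within `[a, b], continuous (F i)}) ->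
  {within `[a, b], continuous (fun s => \sum_(i <- r) F i s)}.
Proof.
move=> cF; elim: r => [|i r IH].
  apply: (@eq_within_continuous _ _ (fun=> 0)); last exact: within_continuous_cst.
  by move=> s _; rewrite big_nil.
apply: (@eq_within_continuous _ _ (fun s => F i s + \sum_(j <- r) F j s)).
  by move=> s _; rewrite big_cons.
exact: within_continuousD.
Qed.

Lemma within_continuous_mx (m n : nat) a b (f : R -> 'M[R]_(m, n)) :
  (forall i j, {within `[a, b], continuous (fun s => f s i j)}) ->
  {within `[a, b], continuous f}.
Proof.
move=> cf; apply/subspace_continuousP => x xab; apply/cvgrPdist_le => e e0.
have H (ij : 'I_m * 'I_n) : \forall t \near within `[a, b] (nbhs x),
    `|f x ij.1 ij.2 - f t ij.1 ij.2| <= e.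
  have /subspace_continuousP/(_ x xab) c := cf ij.1 ij.2.
  by move/cvgrPdist_le : c => /(_ e e0).
have : \forall t \near within `[a, b] (nbhs x), forall ij : 'I_m * 'I_n,
    `|f x ij.1 ij.2 - f t ij.1 ij.2| <= e by exact: filter_forall.
apply: filterS => t Ht.
by apply: mx_norm_le => [|i j]; [exact: ltW|rewrite !mxE; exact: (Ht (i, j))].
Qed.

Lemma within_continuous_integrable a b f : {within `[a, b], continuous f} ->
  mu.-integrable `[a, b] (EFin \o f).
Proof. by apply: continuous_compact_integrable; exact: segment_compact. Qed.

Lemma within_continuous_bounded a b f : {within `[a, b], continuous f} ->
  exists2 M, 0 < M & forall s, s \in `[a, b] -> `|f s| <= M.
Proof.
move=> cf; have /compact_bounded[M [Mr HM]] :=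
  continuous_compact cf (@segment_compact R a b).
exists (`|M| + 1) => [|s sab]; first by rewrite ltr_wpDl.
apply: (HM (`|M| + 1)); last by exists s.
by rewrite (le_lt_trans (ler_norm M))// ltrDl.
Qed.

Lemma within_continuous_measurable a b f : {within `[a, b], continuous f} ->
  measurable_fun `[a, b] f.
Proof.
by move=> /within_continuous_integrable /(measurable_int mu) /measurable_EFinP.
Qed.

Lemma Rintegral_itv_cst u v (c : R) : u <= v ->
  \int[mu]_(t in `[u, v]) c = (v - u) * c.
Proof.
move=> uv.
have muuv : fine (mu `[u, v]%classic) = v - u.
  rewrite lebesgue_measure_itv/= lte_fin; case: ltP => //= vu.
  by rewrite (@le_anti _ _ u v) ?uv// subrr.
by rewrite Rintegral_cst// muuv mulrC.
Qed.

(** The variation function [T] and [T - f] are both monotone. *)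
Lemma ac_primitive a b f : a < b -> abs_continuous_on a b f ->
  exists phi, is_primitive a b phi f.
Proof.
move=> ab ac; have leab := ltW ab; have bv := ac_bounded_variation leab ac.
pose T x := fine (total_variation a x f).
have acT : abs_continuous_on a b T by exact: ac_total_variation.
have finT x : x \in `[a, b] -> total_variation a x f \is a fin_num.
  rewrite in_itv/= => /andP[ax xb].
  exact/(bounded_variationP _ ax)/(bounded_variationl ax xb).
have TD x y : x \in `[a, b] -> y \in `[a, b] -> x <= y -> `|f y - f x| <= T y - T x.
  move=> xab yab xy; have [fx fy] := (finT _ xab, finT _ yab).
  move: xab yab; rewrite !in_itv/= => /andP[ax xb] /andP[ay yb].
  rewrite (total_variationD f ax xy) in fy; rewrite /T (total_variationD f ax xy).
  move: (fy); rewrite fin_numD => /andP[_ fxy].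
  by rewrite fineD// addrAC subrr add0r -lee_fin fineK// total_variation_ge.
have [p1 H1] : exists phi, is_primitive a b phi T.
  apply: monotone_ac_density => // x y xab yab xy.
  by rewrite -subr_ge0 (le_trans _ (TD x y _ _ _)).
have [p2 H2] : exists phi, is_primitive a b phi (fun x => T x - f x).
  apply: monotone_ac_density => // [|x y xab yab xy].
    apply: (ac_dominated (C := 1) _ acT ac) => u v _ _.
    have -> : T v - f v - (T u - f u) = (T v - T u) - (f v - f u) by ring.
    by rewrite mul1r ler_normB.
  have := le_trans (ler_norm _) (TD x y xab yab xy); lra.
exists (fun s => p1 s - p2 s).
by apply: eq_is_primitive (is_primitiveB H1 H2) => s _; rewrite subKr.
Qed.

(** Lebesgue differentiation, for [phi] extended by zero outside [[a, b]]. *)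
Lemma is_primitive_derive_ae a b phi f : a < b -> is_primitive a b phi f ->
  {ae mu, forall s, `[a, b]%classic s -> has_derive_on a b f s (phi s)}.
Proof.
move=> ab [ip Hf].
pose g := phi \_ `[a, b].
have ig : mu.-integrable setT (EFin \o g).
  by rewrite -restrict_EFin; apply/(integrable_mkcond _ _).1.
have igy y : mu.-integrable `]-oo, y] (EFin \o g) by exact: integrableS ig.
have := FTC1Ny igy (integrable_locally (measurable_itv _) ip).
apply: ae_imply => s H sab.
have [ds Ds] := H.
pose F y := \int[mu]_(t in `]-oo, y]) g t.
have fF t : t \in `[a, b] -> f t = f a + F t - F a.
  rewrite in_itv/= => /andP[at_ tb]; rewrite (Hf t at_ tb) -addrA; congr (_ + _).
  rewrite /F Rintegral_itvB; [|exact: igy|by []|by rewrite bnd_simp].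
  rewrite Rintegral_itv_obnd_cbnd; last exact: integrableS ig.
  apply: eq_Rintegral => x; rewrite inE/= => /(itv_sub (lexx a) tb) xab.
  by rewrite /g patchE mem_set.
apply/has_derive_onP => e e0.
have gs : g s = phi s by rewrite /g patchE mem_set.
move: ds; rewrite /derivable => dcvg.
have : h^-1 *: (F (h *: 1 + s) - F s) @[h --> 0^'] --> phi s.
  by rewrite -gs -Ds derive1E; exact: dcvg.
move=> /cvgrPdist_le/(_ e e0)[d /= d0 dH].
exists d => // t tab ts; rewrite (fF t tab) (fF s sab).
have -> : f a + F t - F a - (f a + F s - F a) = F t - F s by ring.
have [->|nts] := eqVneq t s; first by rewrite !subrr scale0r subr0 !normr0 mulr0.
have ts0 : t - s != 0 by rewrite subr_eq0.
have := dH (t - s); rewrite /= sub0r normrN => /(_ ts ts0).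
rewrite [(t - s) *: 1]mulr1 subrK => {}H'.
have -> : F t - F s - (t - s) *: phi s =
    - ((t - s) * (phi s - (t - s)^-1 *: (F t - F s))).
  by rewrite /GRing.scale/=; field.
by rewrite normrN normrM mulrC ler_wpM2r.
Qed.

(** The density of an absolutely continuous function is known once its derivative
    is known almost everywhere; the product and chain rules for primitives are
    thereby reduced to the pointwise ones. *)
Lemma ac_derive_ae_primitive a b f psi : a < b -> abs_continuous_on a b f ->
  measurable_fun `[a, b] psi ->
  {ae mu, forall s, `[a, b]%classic s -> has_derive_on a b f s (psi s)} ->
  is_primitive a b psi f.
Proof.
move=> ab /(ac_primitive ab)[phi Hphi] mpsi ae.
apply: (is_primitive_ae mpsi _ Hphi).
have := is_primitive_derive_ae ab Hphi; move: ae; apply: ae_imply2 => s H1 H2 sab.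
by apply: (has_derive_on_unique ab _ (H2 sab) (H1 sab)).
Qed.

Lemma is_primitive_continuous a b phi f : is_primitive a b phi f ->
  {within `[a, b], continuous f}.
Proof. by move=> /is_primitive_ac/ac_continuous. Qed.

Lemma is_primitiveM a b phi psi f g : a < b -> is_primitive a b phi f ->
  is_primitive a b psi g ->
  is_primitive a b (fun s => phi s * g s + f s * psi s) (fun s => f s * g s).
Proof.
move=> ab Hf Hg.
have [cf cg] := (is_primitive_continuous Hf, is_primitive_continuous Hg).
have [ipf ipg] := (Hf.1, Hg.1).
apply: ac_derive_ae_primitive => //.
- have [M M0 HM] := within_continuous_bounded cf.
  have [N N0 HN] := within_continuous_bounded cg.
  apply: (ac_dominated (C := M + N) _ (is_primitive_ac Hf) (is_primitive_ac Hg)).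
  move=> u v uab vab.
  have -> : f v * g v - f u * g u = (f v - f u) * g v + f u * (g v - g u) by ring.
  rewrite (le_trans (ler_normD _ _))// !normrM mulrDl.
  have := HN v vab; have := HM u uab.
  have := normr_ge0 (f v - f u); have := normr_ge0 (g v - g u).
  by nra.
- by apply: measurable_funD; apply: measurable_funM;
    by [exact: within_continuous_measurable|
        apply/measurable_EFinP; exact: (measurable_int mu)].
- have := is_primitive_derive_ae ab Hg.
  have := is_primitive_derive_ae ab Hf; apply: ae_imply2 => s H1 H2 sab.
  by apply: has_derive_onM; [exact: H1|exact: H2].
Qed.

Lemma is_primitive_comp a b phi f (F F' : R -> R) C : a < b ->
  is_primitive a b phi f ->
  (forall x y, `|F x - F y| <= C * `|x - y|) ->
  (forall x, is_derive x (1 : R) F (F' x)) -> continuous F' ->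
  is_primitive a b (fun s => F' (f s) * phi s) (fun s => F (f s)).
Proof.
move=> ab Hf lipF dF cF'; have acf := is_primitive_ac Hf.
apply: ac_derive_ae_primitive => //.
- apply: (ac_dominated (C := `|C|) _ acf acf) => u v _ _.
  rewrite (le_trans (lipF _ _))// (@le_trans _ _ (`|C| * `|f v - f u|))//.
    by rewrite ler_wpM2r// ler_norm.
  by rewrite ler_wpM2l// lerDl.
- apply: measurable_funM; last first.
    by apply/measurable_EFinP; exact: (measurable_int mu Hf.1).
  apply: (measurableT_comp (f := F')); first exact: continuous_measurable_fun.
  apply: within_continuous_measurable; exact: is_primitive_continuous Hf.
- have := is_primitive_derive_ae ab Hf; apply: ae_imply => s H sab.
  by apply: has_derive_on_comp => //; exact: H.
Qed.

(** At every point, the endpoints included, and not only almost everywhere. *)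
Lemma continuous_primitive_has_derive a b phi f s : is_primitive a b phi f ->
  {within `[a, b], continuous phi} -> s \in `[a, b] ->
  has_derive_on a b f s (phi s).
Proof.
move=> Hf cphi sab; apply/has_derive_onP => e e0.
move/subspace_continuousP : cphi => /(_ s sab) /cvgrPdist_le/(_ e e0)[d /= d0 dH].
exists d => // t tab ts.
have key u v : u <= v -> a <= u -> v <= b -> (forall x, u <= x -> x <= v -> `|s - x| < d) ->
    `|f v - f u - (v - u) * phi s| <= e * (v - u).
  move=> uv au vb close; have iuv := integrable_sub au vb Hf.1.
  have cst_int (c : R) : mu.-integrable `[u, v] (EFin \o (fun=> c)).
    apply: within_continuous_integrable.
    exact: within_continuous_cst.
  have int_cst (c : R) : \int[mu]_(x in `[u, v]) c = (v - u) * c.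
    exact: Rintegral_itv_cst.
  have idiff : mu.-integrable `[u, v] (EFin \o (fun x => phi x - phi s)).
    by apply: (integrableB _ iuv (cst_int _)).
  rewrite (is_primitive_itv Hf au uv vb) -int_cst -RintegralB//.
  rewrite (le_trans (le_normr_Rintegral _ idiff))// mulrC -int_cst.
  apply: le_Rintegral => //; first exact: integrable_norm.
  move=> x; rewrite /= in_itv/= => /andP[ux xv]; rewrite distrC.
  apply: dH; first exact: close.
  by rewrite /= in_itv/= (le_trans au ux) (le_trans xv vb).
move: sab tab; rewrite !in_itv/= => /andP[as_ sb] /andP[at_ tb].
have [st|st] := leP s t.
  rewrite [`|t - s|]ger0_norm ?subr_ge0//; apply: key => // x sx xt.
  move: ts; rewrite ger0_norm ?subr_ge0// distrC ger0_norm ?subr_ge0//; lra.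
have ts0 := ltW st.
have -> : f t - f s - (t - s) *: phi s = - (f s - f t - (s - t) * phi s).
  by rewrite /GRing.scale/=; ring.
rewrite normrN (_ : `|t - s| = s - t); last by rewrite distrC ger0_norm ?subr_ge0.
apply: key => // x tx xs.
move: ts; rewrite distrC ger0_norm ?subr_ge0// ger0_norm ?subr_ge0//; lra.
Qed.

End FundamentalTheorem.
(** * Square-integrable derivatives *)

Section SquareIntegrable.
Context {R : realType}.
Notation mu := (@lebesgue_measure R).
Implicit Types (a b s t u v : R) (f g phi psi : R -> R).

Definition square_integrable a b phi := measurable_fun `[a, b] phi /\
  mu.-integrable `[a, b] (EFin \o (fun s => phi s ^+ 2)).

Lemma square_integrableM a b phi psi : square_integrable a b phi ->
  square_integrable a b psi ->
  mu.-integrable `[a, b] (EFin \o (fun s => phi s * psi s)).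
Proof.
move=> [mp ip] [mq iq].
apply: (le_integrable _ _ _ (integrableD _ ip iq)) => //.
  by apply/measurable_EFinP; exact: measurable_funM.
move=> x _ /=; rewrite lee_fin [leRHS]ger0_norm ?addr_ge0 ?sqr_ge0//.
rewrite ler_norml; have := sqr_ge0 (phi x + psi x); have := sqr_ge0 (phi x - psi x).
have := sqr_ge0 (phi x); have := sqr_ge0 (psi x).
by rewrite !expr2 => *; apply/andP; split; nra.
Qed.

Lemma continuous_square_integrable a b phi : {within `[a, b], continuous phi} ->
  square_integrable a b phi.
Proof.
move=> cp; split; first exact: within_continuous_measurable.
apply: within_continuous_integrable.
apply: (@eq_within_continuous _ _ _ (fun s => phi s * phi s)).
  by move=> s _; rewrite expr2.
exact: within_continuousM.
Qed.

Lemma square_integrable_cst a b (c : R) : square_integrable a b (fun=> c).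
Proof.
exact/continuous_square_integrable/within_continuous_cst.
Qed.

Lemma square_integrable_integrable a b phi : square_integrable a b phi ->
  mu.-integrable `[a, b] (EFin \o phi).
Proof.
move=> sp; have := square_integrableM sp (square_integrable_cst a b 1).
by congr (mu.-integrable _ _); apply/funext => x /=; rewrite mulr1.
Qed.

Lemma square_integrableD a b phi psi : square_integrable a b phi ->
  square_integrable a b psi -> square_integrable a b (fun s => phi s + psi s).
Proof.
move=> sp sq; have [mp ip] := sp; have [mq iq] := sq.
split; first exact: measurable_funD.
have H := integrableD _ (integrableD _ ip iq)
  (integrableD _ (square_integrableM sp sq) (square_integrableM sp sq)).
have := H (measurable_itv _) (measurable_itv _) (measurable_itv _).
by congr (mu.-integrable _ _); apply/funext => x /=; rewrite -!EFinD; congr EFin; ring.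
Qed.

Lemma square_integrable_bM a b phi psi M : square_integrable a b phi ->
  measurable_fun `[a, b] psi -> (forall s, s \in `[a, b] -> `|psi s| <= M) ->
  square_integrable a b (fun s => psi s * phi s).
Proof.
move=> [mp ip] mpsi HM; split; first exact: measurable_funM.
apply: (le_integrable _ _ _ (integrableZl _ (M ^+ 2) ip)) => //.
  by apply/measurable_EFinP; apply: measurable_funX; exact: measurable_funM.
move=> x xab /=; rewrite lee_fin (ger0_norm (mulr_ge0 (sqr_ge0 M) (sqr_ge0 (phi x)))).
rewrite [leLHS]ger0_norm ?sqr_ge0// exprMn ler_wpM2r ?sqr_ge0//.
have Mx := HM x xab.
by rewrite -real_normK ?num_real// ler_pXn2r// nnegrE (le_trans _ Mx).
Qed.

Lemma square_integrableZ a b phi (c : R) : square_integrable a b phi ->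
  square_integrable a b (fun s => c * phi s).
Proof.
move=> sp; apply: (@square_integrable_bM _ _ _ _ `|c| sp) => //.
Qed.

Lemma continuous_square_integrableM a b phi psi : square_integrable a b phi ->
  {within `[a, b], continuous psi} -> square_integrable a b (fun s => psi s * phi s).
Proof.
move=> sp cpsi; have [M _ HM] := within_continuous_bounded cpsi.
apply: square_integrable_bM sp _ HM; exact: within_continuous_measurable.
Qed.

(** Cauchy-Schwarz, from the nonnegativity of the integral of the squared
    distance of [phi] to its mean. *)
Lemma primitive_hoelder a b phi f u v : is_primitive a b phi f ->
  square_integrable a b phi -> a <= u -> u < v -> v <= b ->
  (f v - f u) ^+ 2 / (v - u) <= \int[mu]_(t in `[u, v]) phi t ^+ 2.
Proof.
move=> pf [mp ip] au uv vb; have uv0 : 0 < v - u by rewrite subr_gt0.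
have luv := ltW uv.
pose c := (f v - f u) / (v - u).
have i1 := integrable_sub au vb pf.1; have i2 := integrable_sub au vb ip.
have ic (r : R) : mu.-integrable `[u, v] (EFin \o (fun=> r)).
  exact/within_continuous_integrable/within_continuous_cst.
have i1c : mu.-integrable `[u, v] (EFin \o (fun t => (2 * c) * phi t)).
  exact: (integrableZl _ (2 * c) i1).
have i3 : mu.-integrable `[u, v] (EFin \o (fun t => phi t ^+ 2 - (2 * c) * phi t)).
  exact: (integrableB _ i2 i1c).
have : 0 <= \int[mu]_(t in `[u, v]) (phi t ^+ 2 - (2 * c) * phi t + c ^+ 2).
  apply: Rintegral_ge0 => t _; have := sqr_ge0 (phi t - c); nra.
rewrite RintegralD// RintegralB// RintegralZl// -(is_primitive_itv pf)//.
rewrite Rintegral_itv_cst//.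
have -> : (f v - f u) ^+ 2 / (v - u) = 2 * c * (f v - f u) - c ^+ 2 * (v - u).
  by rewrite /c; field; rewrite gt_eqF.
lra.
Qed.

Lemma Rintegral_subset_le a b psi (A : set R) : measurable A ->
  A `<=` `[a, b]%classic -> mu.-integrable `[a, b] (EFin \o psi) ->
  (forall s, 0 <= psi s) ->
  \int[mu]_(t in A) psi t <= \int[mu]_(t in `[a, b]) psi t.
Proof.
move=> mA sub ip psi0; apply: fine_le.
- by apply: integrable_fin_num => //; exact: integrableS ip.
- exact: integrable_fin_num.
- apply: ge0_subset_integral => //; first exact: (measurable_int mu ip).
  by move=> s _; rewrite lee_fin.
Qed.

Lemma Rintegral_sum (I : Type) (r : seq I) u v (F : I -> R -> R) :
  (forall i, mu.-integrable `[u, v] (EFin \o F i)) ->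
  \int[mu]_(t in `[u, v]) (\sum_(i <- r) F i t) =
  \sum_(i <- r) \int[mu]_(t in `[u, v]) F i t.
Proof.
move=> iF; apply: EFin_inj; rewrite -sumEFin [in LHS]/Rintegral fineK; last first.
  apply: integrable_fin_num => //.
  have H : mu.-integrable `[u, v] (fun t => \sum_(i <- r) (F i t)%:E)%E.
    by apply: integrable_sum => // i _; exact: iF.
  by move: H; congr (mu.-integrable _ _); apply/funext => t /=; rewrite sumEFin.
under eq_integral do rewrite -sumEFin.
rewrite integral_sum//; apply: eq_bigr => i _.
by rewrite /Rintegral fineK//; apply: integrable_fin_num => //; exact: iF.
Qed.

(** Fatou's lemma for a sequence that converges almost everywhere and whose
    integrals are asymptotically at most [c]. *)
Lemma fatou_bound a b (w : nat -> R -> R) psi (c : R) :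
  (forall N, measurable_fun `[a, b] (w N)) ->
  (forall N s, 0 <= w N s) -> measurable_fun `[a, b] psi ->
  {ae mu, forall s, `[a, b]%classic s -> w N s @[N --> \oo] --> psi s} ->
  (forall e, 0 < e -> \forall N \near \oo,
    (\int[mu]_(s in `[a, b]) (w N s)%:E <= (c + e)%:E)%E) ->
  (\int[mu]_(s in `[a, b]) (psi s)%:E <= c%:E)%E.
Proof.
move=> mw w0 mpsi ae bound.
pose W N s := (w N s)%:E.
have mW N : measurable_fun `[a, b] (W N) by exact/measurable_EFinP.
have -> : (\int[mu]_(s in `[a, b]) (psi s)%:E =
           \int[mu]_(s in `[a, b]) limn_einf (W^~ s))%E.
  apply: ae_eq_integral => //; first exact/measurable_EFinP.
    have -> : (fun s => limn_einf (W^~ s)) =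
        (fun s => - limn_esup ((fun N s => - W N s)%E^~ s))%E.
      apply/funext => s; rewrite -limn_einfN; congr limn_einf.
      by apply/funext => N /=; rewrite ?oppeK ?opprK.
    apply: measurableT_comp => //; apply: measurable_fun_limn_esup => N.
    by apply: measurableT_comp => //; exact: mW.
  apply: ae_imply ae => s H sab; have {}H := H sab.
  have cW : W N s @[N --> \oo] --> (psi s)%:E by apply: cvg_EFin => //; exact: nearW.
  by rewrite is_cvg_limn_einfE; [apply/esym/cvg_lim|apply/cvg_ex; exists (psi s)%:E].
have W0 N s : `[a, b]%classic s -> (0 <= W N s)%E by move=> _; rewrite lee_fin.
apply: (le_trans (fatou mu (measurable_itv _) mW W0)).
apply/lee_addgt0Pr => e e0; rewrite limn_einf_lim.
apply: lime_le; first exact: is_cvg_einfs.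
apply: nearW => k; have [N0 _ HN] := bound e e0.
apply: (@le_trans _ _ (\int[mu]_(s in `[a, b]) W (maxn N0 k) s)%E).
  by apply: ereal_inf_lbound; exists (maxn N0 k) => //=; rewrite leq_maxr.
by rewrite -EFinD; apply: HN => /=; rewrite leq_maxl.
Qed.

End SquareIntegrable.
(** * Discrete energies on uniform meshes *)

Section Mesh.
Context {R : realType}.
Notation mu := (@lebesgue_measure R).
Variables (a b : R).
Hypothesis ab : a < b.
Implicit Types (s t : R) (f g phi psi : R -> R) (N : nat).

Definition mesh_step N : R := (b - a) / N.+1%:R.

Definition mesh N (i : nat) : R := a + mesh_step N *+ i.

Definition discrete_energy f N : R :=
  \sum_(i < N.+1) (f (mesh N i.+1) - f (mesh N i)) ^+ 2 / mesh_step N.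

Lemma mesh_step_gt0 N : 0 < mesh_step N.
Proof. by rewrite divr_gt0 ?subr_gt0. Qed.

Lemma mesh_stepE N : mesh_step N *+ N.+1 = b - a.
Proof. by rewrite -mulr_natr /mesh_step divfK. Qed.

Lemma mesh0 N : mesh N 0 = a.
Proof. by rewrite /mesh mulr0n addr0. Qed.

Lemma mesh_last N : mesh N N.+1 = b.
Proof. by rewrite /mesh mesh_stepE addrC subrK. Qed.

Lemma meshS N i : mesh N i.+1 = mesh N i + mesh_step N.
Proof. by rewrite /mesh mulrSr addrA. Qed.

Lemma mesh_ltS N i : mesh N i < mesh N i.+1.
Proof. by rewrite meshS ltrDl mesh_step_gt0. Qed.

Lemma mesh_le N i j : (i <= j)%N -> mesh N i <= mesh N j.
Proof. by move=> ij; rewrite lerD2l ler_wpMn2l// ltW// mesh_step_gt0. Qed.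

Lemma mesh_ge N i : a <= mesh N i.
Proof. by rewrite -{1}(mesh0 N) mesh_le. Qed.

Lemma mesh_le_last N i : (i <= N.+1)%N -> mesh N i <= b.
Proof. by move=> iN; rewrite -[leRHS](mesh_last N) mesh_le. Qed.

Lemma mesh_step_small d : 0 < d -> \forall N \near \oo, mesh_step N < d.
Proof.
move=> d0; near=> N.
rewrite /mesh_step ltr_pdivrMr// mulrC -ltr_pdivrMr//.
rewrite (@lt_le_trans _ _ N%:R)//; last by rewrite ler_nat.
by near: N; exact: nbhs_infty_gtr.
Unshelve. all: by end_near. Qed.

Lemma mesh_cell N s : a < s -> s <= b ->
  exists i : 'I_N.+1, mesh N i < s /\ s <= mesh N i.+1.
Proof.
move=> as_ sb.
have ex : exists i, s <= mesh N i.+1 by exists N; rewrite mesh_last.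
case: (ex_minnP ex) => i si min.
have iN : (i < N.+1)%N by rewrite ltnS; apply: min; rewrite mesh_last.
exists (Ordinal iN); split => //=; rewrite ltNge; apply/negP => si'.
case: i si min iN si' => [|i] si min iN si'.
  by move: si'; rewrite mesh0 leNgt as_.
by have := min i si'; rewrite ltnn.
Qed.

Lemma mesh_cell_unique N i j s : mesh N i < s -> s <= mesh N i.+1 ->
  mesh N j < s -> s <= mesh N j.+1 -> i = j.
Proof.
move=> i1 i2 j1 j2; apply/eqP; rewrite eqn_leq; apply/andP; split.
  rewrite leqNgt; apply/negP => ij.
  by have := lt_le_trans i1 (le_trans j2 (mesh_le N ij)); rewrite ltxx.
rewrite leqNgt; apply/negP => ij.
by have := lt_le_trans j1 (le_trans i2 (mesh_le N ij)); rewrite ltxx.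
Qed.

Lemma mesh_integral psi N : mu.-integrable `[a, b] (EFin \o psi) ->
  \sum_(i < N.+1) \int[mu]_(t in `[mesh N i, mesh N i.+1]) psi t =
  \int[mu]_(t in `[a, b]) psi t.
Proof.
move=> ip; have P := is_primitive_integral 0 ip.
rewrite (eq_bigr (fun i : 'I_N.+1 =>
    (\int[mu]_(t in `[a, mesh N i.+1]) psi t) - \int[mu]_(t in `[a, mesh N i]) psi t)).
  rewrite -(big_mkord xpredT (fun i => \int[mu]_(t in `[a, mesh N i.+1]) psi t -
    \int[mu]_(t in `[a, mesh N i]) psi t)).
  rewrite (telescope_sumr (fun i => \int[mu]_(t in `[a, mesh N i]) psi t))//.
  by rewrite mesh_last mesh0 set_itv1 Rintegral_set1 subr0.
move=> i _; have iN : (i.+1 <= N.+1)%N by exact: ltn_ord.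
rewrite -(is_primitive_itv P (mesh_ge _ _) (ltW (mesh_ltS _ _)) (mesh_le_last iN)).
by rewrite !add0r.
Qed.

Lemma discrete_energy_le phi f N : is_primitive a b phi f ->
  square_integrable a b phi ->
  discrete_energy f N <= \int[mu]_(t in `[a, b]) phi t ^+ 2.
Proof.
move=> pf sp; rewrite -(mesh_integral N sp.2); apply: ler_sum => i _.
have iN : (i.+1 <= N.+1)%N by exact: ltn_ord.
rewrite (_ : mesh_step N = mesh N i.+1 - mesh N i); last by rewrite meshS; ring.
apply: (primitive_hoelder pf sp); [exact: mesh_ge|exact: mesh_ltS|exact: mesh_le_last].
Qed.

(** The straddle lemma: the difference quotients over the cells that contain [s]
    converge although [s] need not be a node, because the errors at the two ends
    add up to at most [e] times the length of the cell. *)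
Lemma mesh_quotient_cvg f s l (i : nat -> nat) : has_derive_on a b f s l ->
  (forall N, (i N < N.+1)%N /\ mesh N (i N) < s /\ s <= mesh N (i N).+1) ->
  (f (mesh N (i N).+1) - f (mesh N (i N))) / mesh_step N @[N --> \oo] --> l.
Proof.
move=> /has_derive_onP H Hi; apply/cvgrPdist_le => e /H[d d0 dH].
near=> N; have [iN [lts les]] := Hi N.
have h0 := mesh_step_gt0 N.
have hd : mesh_step N < d by near: N; exact: mesh_step_small.
set t := mesh N (i N) in lts *; set t' := mesh N (i N).+1 in les *.
have t'E : t' = t + mesh_step N by exact: meshS.
have tab : t \in `[a, b] by rewrite in_itv/= mesh_ge mesh_le_last// ltnW.
have t'ab : t' \in `[a, b] by rewrite in_itv/= mesh_ge mesh_le_last.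
have h1 : `|t - s| = s - t by rewrite distrC ger0_norm// subr_ge0 ltW.
have h2 : `|t' - s| = t' - s by rewrite ger0_norm// subr_ge0.
have b1 : `|f t - f s - (t - s) * l| <= e * (s - t).
  by have := dH t tab; rewrite h1; apply; lra.
have b2 : `|f t' - f s - (t' - s) * l| <= e * (t' - s).
  by have := dH t' t'ab; rewrite h2; apply; lra.
rewrite -(ler_pM2r h0).
rewrite -[X in _ * X <= _](gtr0_norm h0) -normrM.
have -> : (l - (f t' - f t) / mesh_step N) * mesh_step N =
    (f t - f s - (t - s) * l) - (f t' - f s - (t' - s) * l).
  by rewrite t'E; field; rewrite gt_eqF.
rewrite (le_trans (ler_normB _ _))//.
have -> : e * mesh_step N = e * (s - t) + e * (t' - s) by rewrite t'E; ring.
exact: lerD.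
Unshelve. all: by end_near. Qed.

(** Lower semicontinuity. The discrete energy is the integral of the square of a
    step function, the difference quotient of [f] on each cell, and these step
    functions converge almost everywhere to the derivative. *)
Lemma discrete_energy_fatou (I : finType) (f phi : I -> R -> R) (c : R) :
  (forall k, is_primitive a b (phi k) (f k)) ->
  (forall e, 0 < e -> \forall N \near \oo,
    \sum_k discrete_energy (f k) N <= c + e) ->
  (forall k, square_integrable a b (phi k)) /\
  \sum_k \int[mu]_(t in `[a, b]) phi k t ^+ 2 <= c.
Proof.
move=> pf bound.
have mphi k : measurable_fun `[a, b] (phi k).
  by apply/measurable_EFinP; exact: (measurable_int mu (pf k).1).
pose C N (i : nat) := \sum_k ((f k (mesh N i.+1) - f k (mesh N i)) / mesh_step N) ^+ 2.
pose cell N (i : nat) : set R := `]mesh N i, mesh N i.+1]%classic.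
(* The sum over [k] of the squared step functions. *)
pose w N s := \sum_(i < N.+1) C N i * \1_(cell N i) s.
have C0 N i : 0 <= C N i by apply: sumr_ge0 => k _; exact: sqr_ge0.
have mcell N i : measurable (cell N i) by exact: measurable_itv.
pose psi s := \sum_k phi k s ^+ 2.
have mpsi : measurable_fun `[a, b] psi.
  by apply: measurable_sum => k; exact: measurable_funX.
have wE N s (i : 'I_N.+1) : mesh N i < s -> s <= mesh N i.+1 -> w N s = C N i.
  move=> i1 i2; rewrite /w (bigD1 i)//= big1 => [|j ji].
    by rewrite addr0 indicE mem_set ?mulr1// /cell/= in_itv/= i1.
  rewrite indicE memNset ?mulr0//; rewrite /cell/= in_itv/= => /andP[j1 j2].
  by move: ji; rewrite -val_eqE/= (mesh_cell_unique i1 i2 j1 j2) eqxx.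
have main : (\int[mu]_(s in `[a, b]) (psi s)%:E <= c%:E)%E.
  apply: (@fatou_bound _ a b w) => //.
  - move=> N; apply: measurable_sum => i; exact: measurable_funM.
  - by move=> N s; apply: sumr_ge0 => i _; rewrite mulr_ge0// indicE.
  - have ae1 := ae_forall (fun k => is_primitive_derive_ae ab (pf k)).
    have ae2 : {ae mu, forall s, s != a}.
      exists [set a]; split => //; first exact: lebesgue_measure_set1.
      by move=> s /= /negP; rewrite negbK => /eqP.
    apply: ae_imply2 ae1 ae2 => s H sa sab.
    have [as_ sb] : a < s /\ s <= b.
      by move: sab; rewrite /= in_itv/= lt_neqAle eq_sym sa => /andP[-> ->].
    have /choice[i Hi] : forall N, exists i, (i < N.+1)%N /\ mesh N i < s /\ s <= mesh N i.+1.
      by move=> N; have [i] := mesh_cell N as_ sb; exists i.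
    have -> : w^~ s = fun N => \sum_k
        ((f k (mesh N (i N).+1) - f k (mesh N (i N))) / mesh_step N) ^+ 2.
      apply/funext => N; have [iN [i1 i2]] := Hi N.
      exact: (wE N s (Ordinal iN)).
    apply: cvg_big => [|k _]; first exact: add_continuous.
    rewrite expr2; under eq_fun do rewrite expr2.
    by apply: cvgM; exact: mesh_quotient_cvg (H k sab) Hi.
  - move=> e /bound; apply: filterS => N; rewrite -lee_fin; apply: le_trans.
    rewrite /w; under eq_integral do rewrite -sumEFin.
    rewrite ge0_integral_sum//; last 2 first.
    + move=> i; apply/measurable_EFinP.
      by apply: (@measurable_funM _ _ _ _ (fun=> C N i) (\1_(cell N i))).
    + by move=> i s _; rewrite lee_fin mulr_ge0// indicE.
    rewrite /discrete_energy exchange_big/= -sumEFin; apply: lee_sum => i _.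
    under eq_integral do rewrite EFinM.
    rewrite ge0_integralZl//; last 2 first.
    + by apply/measurable_EFinP; apply: measurable_indic; exact: mcell.
    + by rewrite lee_fin.
    rewrite integral_indic//; last exact: mcell.
    apply: (@le_trans _ _ ((C N i)%:E * (mesh_step N)%:E)%E).
      rewrite lee_wpmul2l ?lee_fin//.
      apply: (@le_trans _ _ (mu (cell N i))).
        apply: le_measure; rewrite ?inE; [|exact: mcell|by move=> s []].
        by apply: measurableI => //; exact: mcell.
      rewrite -[leLHS]/(lebesgue_measure (`]mesh N i, mesh N i.+1]%classic : set R)).
      by rewrite lebesgue_measure_itv/= lte_fin mesh_ltS -EFinB lee_fin meshS addrC addKr.
    rewrite -EFinM lee_fin /C mulr_suml; apply: ler_sum => k _.
    by rewrite le_eqVlt; apply/orP; left; apply/eqP; field; rewrite gt_eqF// mesh_step_gt0.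
have psi0 s : 0 <= psi s by apply: sumr_ge0 => k _; exact: sqr_ge0.
have ipsi : mu.-integrable `[a, b] (EFin \o psi).
  apply/integrableP; split; first exact/measurable_EFinP.
  apply: le_lt_trans (ltry c); apply: le_trans main.
  rewrite le_eqVlt; apply/orP; left; apply/eqP/eq_integral => s _ /=.
  by rewrite ger0_norm.
have sq k : square_integrable a b (phi k).
  split => //; apply: (le_integrable _ _ _ ipsi) => //.
    by apply/measurable_EFinP; apply: measurable_funX; exact: mphi.
  move=> s _ /=; rewrite lee_fin (ger0_norm (psi0 s)) (ger0_norm (sqr_ge0 _)).
  by rewrite /psi (bigD1 k)//= lerDl sumr_ge0// => j _; exact: sqr_ge0.
split=> //; rewrite -lee_fin; apply: le_trans main.
rewrite -sumEFin.
have -> : (\int[mu]_(s in `[a, b]) (psi s)%:E =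
    \int[mu]_(s in `[a, b]) \sum_k (phi k s ^+ 2)%:E)%E.
  by apply: eq_integral => s _; rewrite sumEFin.
rewrite ge0_integral_sum//; last 2 first.
- by move=> k; apply/measurable_EFinP; apply: measurable_funX; exact: mphi.
- by move=> k s _; rewrite lee_fin sqr_ge0.
apply: lee_sum => k _; rewrite /Rintegral fineK//.
by apply: integrable_fin_num => //; exact: (sq k).2.
Qed.

End Mesh.
(** * Existence of minimizers of the action *)

Lemma continuous_sum (R : realType) (T : topologicalType) (I : Type) (r : seq I)
    (F : I -> T -> R) :
  (forall i, continuous (F i)) -> continuous (fun y => \sum_(i <- r) F i y).
Proof.
move=> cF; elim: r => [|i r IH] y.
  rewrite (_ : (fun y => _) = fun=> 0); first exact: cvg_cst.
  by apply/funext => z; rewrite big_nil.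
rewrite (_ : (fun y => _) = fun y => F i y + \sum_(j <- r) F j y).
  by apply: cvgD; [exact: cF|exact: IH].
by apply/funext => z; rewrite big_cons.
Qed.

Section PointwiseCluster.
Context {R : realType} (J : eqType).

Notation cube := (prod_topology (fun _ : J => R)).

(** By Tychonoff's theorem, a uniformly bounded sequence of functions has a
    pointwise cluster point. No subsequence is extracted: a bound on a continuous
    function of finitely many values that holds along the sequence passes to [p]. *)
Lemma pointwise_cluster (x : nat -> cube) (M : R) :
  (forall m j, `|x m j| <= M) ->
  exists p : cube, forall Phi : cube -> R, continuous Phi ->
    forall e, 0 < e -> forall m0, exists2 m, (m0 <= m)%N & `|Phi (x m) - Phi p| < e.
Proof.
move=> xM; have := @tychonoff J (fun=> R) (fun=> `[- M, M]%classic)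
  (fun=> @segment_compact R _ _).
move=> /(_ (x @ \oo) _)[|p [_ Hp]].
  by exists 0%N => // m _ j /=; rewrite in_itv/= -ler_norml.
exists p => Phi cPhi e e0 m0.
have := Hp [set y | exists2 m, (m0 <= m)%N & y = x m] [set y | `|Phi y - Phi p| < e].
case=> [||_ [[m m0m ->] H]]; last by exists m.
  by exists m0 => // m /= m0m; exists m.
have /cvgrPdist_lt/(_ e e0) := cPhi p.
by apply: filterS => y /=; rewrite distrC.
Qed.

Lemma continuous_coordinate (j : J) : continuous (fun y : cube => y j).
Proof. exact: (@proj_continuous J (fun=> R) j). Qed.

End PointwiseCluster.

Section Admissible.
Context {R : realType} (n : nat).
Notation mu := (@lebesgue_measure R).
Variables (a b : R).
Hypothesis ab : a < b.
Implicit Types (g phi S : R -> 'M[R]_n).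

(** An H^1 curve in the orthogonal group together with a representative of its
    derivative. Keeping the derivative as a datum makes admissibility stable under
    changes of [phi] on null sets. *)
Definition admissible g phi := [/\
  forall s, s \in `[a, b] -> orthogonal_group n (g s),
  forall i j, is_primitive a b (fun s => phi s i j) (fun s => g s i j) &
  forall i j, square_integrable a b (fun s => phi s i j)].

Definition kinetic phi : R :=
  \sum_(ij : 'I_n * 'I_n) \int[mu]_(s in `[a, b]) phi s ij.1 ij.2 ^+ 2.

(** The data term of the matching energy is, up to a constant, minus a linear
    functional of this form. *)
Definition coupling S g : R := \int[mu]_(s in `[a, b]) inner_o (g s) (S s).

Definition action S g phi : R := 2^-1 * kinetic phi - coupling S g.

Lemma inner_o_pairE (X Y : 'M[R]_n) :
  inner_o X Y = \sum_(ij : 'I_n * 'I_n) X ij.1 ij.2 * Y ij.1 ij.2.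
Proof. by rewrite inner_oE pair_bigA. Qed.

Lemma orthogonal_entry_le1 (X : 'M[R]_n) i j : orthogonal_group n X -> `|X i j| <= 1.
Proof.
move=> /matrixP/(_ j j); rewrite !mxE eqxx mulr1n => H.
suff : X i j ^+ 2 <= 1 by rewrite -real_normK ?num_real// expr_le1.
rewrite -H (bigD1 i)//= mxE -expr2 lerDl sumr_ge0// => k _.
by rewrite mxE -expr2 sqr_ge0.
Qed.

Lemma kinetic_ge0 phi : 0 <= kinetic phi.
Proof.
apply: sumr_ge0 => ij _; apply: Rintegral_ge0 => s _; exact: sqr_ge0.
Qed.

Lemma kinetic_entry_le phi i j :
  \int[mu]_(s in `[a, b]) phi s i j ^+ 2 <= kinetic phi.
Proof.
rewrite /kinetic (bigD1 (i, j))//= lerDl; apply: sumr_ge0 => ij _.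
apply: Rintegral_ge0 => s _; exact: sqr_ge0.
Qed.

Lemma kinetic_discrete_energy_le g phi N : admissible g phi ->
  \sum_(ij : 'I_n * 'I_n) discrete_energy a b (fun s => g s ij.1 ij.2) N <= kinetic phi.
Proof.
move=> [_ pg sg]; apply: ler_sum => ij _.
exact: (discrete_energy_le ab _ (pg _ _) (sg _ _)).
Qed.

Lemma admissible_hoelder g phi i j u v : admissible g phi ->
  a <= u -> u <= v -> v <= b -> (g v i j - g u i j) ^+ 2 <= kinetic phi * (v - u).
Proof.
move=> [_ pg sg] au; rewrite le_eqVlt => /predU1P[-> _|uv vb].
  by rewrite !subrr expr0n mulr0.
rewrite -ler_pdivrMr ?subr_gt0//.
apply: (le_trans (primitive_hoelder (pg i j) (sg i j) au uv vb)).
apply: le_trans (kinetic_entry_le phi i j).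
apply: Rintegral_subset_le (sg i j).2 _ => //; first exact: itv_sub.
by move=> s; exact: sqr_ge0.
Qed.

(** Curves of bounded kinetic energy are uniformly absolutely continuous: integrate
    [|x| <= x^2 / lam + lam] over the intervals. *)
Lemma bounded_kinetic_ac (C e : R) : 0 < e -> exists2 d, 0 < d &
  forall g phi, admissible g phi -> kinetic phi <= C ->
    forall i j m (u v : 'I_m -> R), (forall l, a <= u l /\ u l <= v l /\ v l <= b) ->
      trivIset setT (fun l => `]u l, v l[%classic) -> \sum_(l < m) (v l - u l) < d ->
      \sum_(l < m) `|g (v l) i j - g (u l) i j| <= e.
Proof.
move=> e0; (* For this [lam] the first term contributes at most [e / 2], and so does the
   second one when the total length is below [e / 2 / lam]. *)
pose lam := (`|C| + 1) / (e / 2).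
have C0 : 0 < `|C| + 1 by rewrite ltr_wpDl.
have e20 : 0 < e / 2 by rewrite divr_gt0.
have lam0 : 0 < lam by rewrite divr_gt0.
exists (e / 2 / lam); first by rewrite divr_gt0.
move=> g phi [_ pg sg] kC i j m u v uv tI len.
have [A [mA Aab _ sumA]] := integral_disjoint_itv (sg i j).2 uv tI.
apply: (@le_trans _ _ (\sum_(l < m) (lam^-1 * \int[mu]_(t in `[u l, v l]) phi t i j ^+ 2
    + lam * (v l - u l)))).
  apply: ler_sum => l _; have [au [ul vb]] := uv l.
  have ip := integrable_sub au vb (pg i j).1.
  have iq := integrable_sub au vb (sg i j).2.
  have iqz : mu.-integrable `[u l, v l] (EFin \o (fun t => lam^-1 * phi t i j ^+ 2)).
    exact: (integrableZl _ lam^-1 iq).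
  have ic : mu.-integrable `[u l, v l] (EFin \o (fun=> lam)).
    exact/within_continuous_integrable/within_continuous_cst.
  rewrite (is_primitive_itv (pg i j) au ul vb) [lam * _]mulrC -Rintegral_itv_cst//.
  rewrite -RintegralZl// -RintegralD//.
  apply: (le_trans (le_normr_Rintegral _ ip)) => //.
  apply: le_Rintegral => //; first exact: integrable_norm.
    exact: (integrableD _ iqz ic).
  move=> t _; set x := phi t i j.
  rewrite -(ler_pM2l lam0) mulrDr mulVKf ?gt_eqF// -(real_normK (num_real x)).
  have := sqr_ge0 (`|x| - lam); have := mulr_ge0 (normr_ge0 x) (ltW lam0).
  rewrite !expr2; nra.
rewrite big_split/= -!mulr_sumr.
have -> : e = e / 2 + e / 2 by rewrite -splitr.
apply: lerD; last by rewrite mulrC -ler_pdivlMr// ltW.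
rewrite sumA mulrC ler_pdivrMr// /lam mulrC divfK ?gt_eqF//.
apply: (le_trans (Rintegral_subset_le mA Aab (sg i j).2 _)).
  by move=> t; exact: sqr_ge0.
rewrite (le_trans (kinetic_entry_le phi i j))// (le_trans kC)//.
by rewrite (le_trans (ler_norm C))// lerDl.
Qed.

Section Coupling.
Variable S : R -> 'M[R]_n.
Hypothesis cS : forall i j, {within `[a, b], continuous (fun s => S s i j)}.

Lemma continuous_inner_o g :
  (forall i j, {within `[a, b], continuous (fun s => g s i j)}) ->
  {within `[a, b], continuous (fun s => inner_o (g s) (S s))}.
Proof.
move=> cg; apply: (@eq_within_continuous _ _ _
  (fun s => \sum_(ij : 'I_n * 'I_n) g s ij.1 ij.2 * S s ij.1 ij.2)).
  by move=> s _; rewrite inner_o_pairE.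
by apply: within_continuous_sum => ij; exact: within_continuousM.
Qed.

Lemma admissible_continuous g phi i j : admissible g phi ->
  {within `[a, b], continuous (fun s => g s i j)}.
Proof. by move=> [_ pg _]; exact: is_primitive_continuous (pg i j). Qed.

Let absS s := \sum_(ij : 'I_n * 'I_n) `|S s ij.1 ij.2|.

Let cabsS : {within `[a, b], continuous absS}.
Proof.
apply: within_continuous_sum => ij; apply: within_continuous_norm.
exact: cS.
Qed.

Let weight := \int[mu]_(s in `[a, b]) absS s.

Let absS_ge0 s : 0 <= absS s.
Proof. exact: sumr_ge0. Qed.

Lemma inner_o_le (X : 'M[R]_n) (d : R) s : (forall i j, `|X i j| <= d) ->
  `|inner_o X (S s)| <= d * absS s.
Proof.
move=> Xd; rewrite inner_o_pairE mulr_sumr (le_trans (ler_norm_sum _ _ _))//.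
by apply: ler_sum => ij _; rewrite normrM ler_wpM2r.
Qed.

Lemma coupling_le g phi : admissible g phi -> coupling S g <= weight.
Proof.
move=> adm; apply: le_Rintegral => //.
- by apply/within_continuous_integrable/continuous_inner_o => i j;
    exact: admissible_continuous adm.
- exact: within_continuous_integrable.
move=> s sab; rewrite (le_trans (ler_norm _))// -[leRHS]mul1r.
by apply: inner_o_le => i j; apply: orthogonal_entry_le1; case: adm => + _ _; exact.
Qed.

Definition discrete_coupling g N : R := \sum_(l < N.+1)
  \sum_(ij : 'I_n * 'I_n) g (mesh a b N l) ij.1 ij.2 *
    \int[mu]_(t in `[mesh a b N l, mesh a b N l.+1]) S t ij.1 ij.2.

Lemma discrete_coupling_approx g N (d : R) :
  (forall i j, {within `[a, b], continuous (fun s => g s i j)}) ->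
  (forall (l : 'I_N.+1) s i j, mesh a b N l <= s -> s <= mesh a b N l.+1 ->
    `|g s i j - g (mesh a b N l) i j| <= d) ->
  `|coupling S g - discrete_coupling g N| <= d * weight.
Proof.
move=> cg close.
have igS := within_continuous_integrable (continuous_inner_o cg).
have iabs := within_continuous_integrable cabsS.
rewrite /coupling -(mesh_integral ab N igS) /discrete_coupling -sumrB.
rewrite /weight -(mesh_integral ab N iabs) mulr_sumr.
apply: (le_trans (ler_norm_sum _ _ _)); apply: ler_sum => l _.
have lN : (l.+1 <= N.+1)%N by exact: ltn_ord.
have la := mesh_ge ab N l; have lb := mesh_le_last ab lN.
have iS ij : mu.-integrable `[mesh a b N l, mesh a b N l.+1]
    (EFin \o (fun t => S t ij.1 ij.2)).
  exact: (integrable_sub la lb (within_continuous_integrable (@cS ij.1 ij.2))).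
set X := g (mesh a b N l).
have cX : {within `[a, b], continuous (fun s => inner_o X (S s))}.
  by apply: (@continuous_inner_o (fun=> X)) => i j; exact: within_continuous_cst.
have iX := integrable_sub la lb (within_continuous_integrable cX).
have igl := integrable_sub la lb igS.
have ial := integrable_sub la lb iabs.
have -> : \sum_ij X ij.1 ij.2 * \int[mu]_(t in `[mesh a b N l, mesh a b N l.+1]) S t ij.1 ij.2
    = \int[mu]_(t in `[mesh a b N l, mesh a b N l.+1]) inner_o X (S t).
  under [RHS]eq_Rintegral do rewrite inner_o_pairE.
  rewrite Rintegral_sum => [|ij]; last exact: (integrableZl _ (X ij.1 ij.2) (iS ij)).
  by apply: eq_bigr => ij _; rewrite RintegralZl.
have iD : mu.-integrable `[mesh a b N l, mesh a b N l.+1]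
    (EFin \o (fun s => inner_o (g s) (S s) - inner_o X (S s))).
  exact: (integrableB _ igl iX).
rewrite -RintegralB// (le_trans (le_normr_Rintegral _ _))// -RintegralZl//.
apply: le_Rintegral => //; first exact: integrable_norm.
  exact: (integrableZl _ d ial).
move=> s /=; rewrite in_itv/= => /andP[s1 s2].
have -> : inner_o (g s) (S s) - inner_o X (S s) = inner_o (g s - X) (S s).
  by rewrite !inner_o_pairE -sumrB; apply: eq_bigr => ij _; rewrite !mxE mulrBl.
by apply: inner_o_le => i j; rewrite !mxE; exact: close.
Qed.

End Coupling.

End Admissible.
Section Existence.
Context {R : realType} (n : nat).
Notation mu := (@lebesgue_measure R).
Variables (a b : R) (S : R -> 'M[R]_n).
Hypothesis ab : a < b.
Hypothesis cS : forall i j, {within `[a, b], continuous (fun s => S s i j)}.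
Implicit Types (g phi : R -> 'M[R]_n).

Let J : eqType := (R * ('I_n * 'I_n))%type.

Notation cube := (prod_topology (fun _ : J => R)).

Let mx_of (y : cube) (s : R) : 'M[R]_n := \matrix_(i, j) y (s, (i, j)).

Let of_mx g : cube := fun j => g (clamp a b j.1) j.2.1 j.2.2.

Let of_mxE g s i j : s \in `[a, b] -> of_mx g (s, (i, j)) = g s i j.
Proof. by rewrite in_itv/= => /andP[as_ sb]; rewrite /of_mx/= clamp_id. Qed.

Let node N (l : nat) := mesh a b N l.

(** The action with the kinetic term replaced by the discrete energy and the
    coupling by a Riemann sum: a continuous function of finitely many
    coordinates, hence compatible with pointwise convergence. *)
Let discrete_action N (y : cube) : R :=
  2^-1 * (\sum_(ij : 'I_n * 'I_n) discrete_energy a b (fun s => y (s, ij)) N) -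
  \sum_(l < N.+1) \sum_(ij : 'I_n * 'I_n) y (node N l, ij) *
    \int[mu]_(t in `[node N l, node N l.+1]) S t ij.1 ij.2.

Let ccoord (j : J) : continuous (fun y : cube => y j).
Proof. exact: continuous_coordinate. Qed.

Let continuousMc (T : topologicalType) (f g : T -> R) :
  continuous f -> continuous g -> continuous (fun y => f y * g y).
Proof. by move=> cf cg y; apply: cvgM; [exact: cf|exact: cg]. Qed.

Let continuousBc (T : topologicalType) (f g : T -> R) :
  continuous f -> continuous g -> continuous (fun y => f y - g y).
Proof. by move=> cf cg y; apply: cvgB; [exact: cf|exact: cg]. Qed.

Let continuous_cstc (T : topologicalType) (c : R) : continuous (fun _ : T => c).
Proof. by move=> y; exact: cvg_cst. Qed.

Let continuous_sqrc (T : topologicalType) (f : T -> R) :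
  continuous f -> continuous (fun y => f y ^+ 2).
Proof.
move=> cf; rewrite (_ : (fun y => _) = fun y => f y * f y); first exact: continuousMc.
by apply/funext => y; rewrite expr2.
Qed.

Let continuous_normc (T : topologicalType) (f : T -> R) :
  continuous f -> continuous (fun y => `|f y|).
Proof. by move=> cf y; apply: cvg_norm; exact: cf. Qed.

Let continuous_discrete_action N : continuous (discrete_action N).
Proof.
apply: continuousBc.
  apply: continuousMc; first exact: continuous_cstc.
  apply: continuous_sum => ij; apply: continuous_sum => l.
  apply: continuousMc; last exact: continuous_cstc.
  by apply: continuous_sqrc; apply: continuousBc; exact: ccoord.
apply: continuous_sum => l; apply: continuous_sum => ij.
by apply: continuousMc; [exact: ccoord|exact: continuous_cstc].
Qed.

Let node_in N l : (l <= N.+1)%N -> node N l \in `[a, b].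
Proof. by move=> lN; rewrite in_itv/= mesh_ge// mesh_le_last. Qed.

Let discrete_actionE N (y : cube) g :
  (forall s i j, s \in `[a, b] -> y (s, (i, j)) = g s i j) ->
  discrete_action N y =
  2^-1 * (\sum_(ij : 'I_n * 'I_n) discrete_energy a b (fun s => g s ij.1 ij.2) N) -
  discrete_coupling a b S g N.
Proof.
move=> yg; congr (_ * _ - _).
  apply: eq_bigr => -[i j] _; apply: eq_bigr => l _ /=.
  have lN : (l.+1 <= N.+1)%N by exact: ltn_ord.
  by rewrite !yg//; apply: node_in => //; exact: ltnW.
apply: eq_bigr => l _; apply: eq_bigr => -[i j] _ /=.
by rewrite yg//; apply: node_in; exact/ltnW/ltn_ord.
Qed.

Let weight := \int[mu]_(s in `[a, b]) \sum_(ij : 'I_n * 'I_n) `|S s ij.1 ij.2|.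

Let weight_ge0 : 0 <= weight.
Proof. by apply: Rintegral_ge0 => s _; exact: sumr_ge0. Qed.

(** Uniform Hoelder continuity makes the Riemann sums converge uniformly over
    the minimizing sequence. *)
Let discrete_coupling_cvg C e : 0 < e -> \forall N \near \oo, forall g,
  (forall i j, {within `[a, b], continuous (fun s => g s i j)}) ->
  (forall i j u v, a <= u -> u <= v -> v <= b ->
    (g v i j - g u i j) ^+ 2 <= C * (v - u)) ->
  `|coupling a b S g - discrete_coupling a b S g N| <= e.
Proof.
move=> e0; pose d := e / (weight + 1).
have w1 : 0 < weight + 1 by rewrite ltr_wpDl.
have d0 : 0 < d by rewrite divr_gt0.
have C1 : 0 < `|C| + 1 by rewrite ltr_wpDl.
have := mesh_step_small a b (divr_gt0 (exprn_gt0 2 d0) C1).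
apply: filterS => N hN g cg hg.
apply: (@le_trans _ _ (d * weight)); last first.
  by rewrite /d mulrAC ler_pdivrMr// ler_pM2l// lerDl.
apply: discrete_coupling_approx => // l s i j ls sl.
have lN : (l.+1 <= N.+1)%N by exact: ltn_ord.
have la := mesh_ge ab N l; have lb := mesh_le_last ab lN.
rewrite -(@ler_pXn2r _ 2)// ?nnegrE ?(ltW d0)// real_normK ?num_real//.
apply: (le_trans (hg i j _ _ la ls (le_trans sl lb))).
rewrite ltr_pdivlMr// mulrC in hN; apply: le_trans (ltW hN).
apply: (@le_trans _ _ ((`|C| + 1) * (s - mesh a b N l))).
  by rewrite ler_wpM2r ?subr_ge0// (le_trans (ler_norm C))// lerDl.
by rewrite ler_pM2l//; move: sl; rewrite meshS; lra.
Qed.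

Lemma admissible_id : admissible a b (fun=> 1%:M) (fun=> (0 : 'M[R]_n)).
Proof.
split=> [s _|i j|i j].
- by rewrite /orthogonal_group/= trmx1 mul1mx.
- have := is_primitive_integral ((1%:M : 'M[R]_n) i j)
    (within_continuous_integrable (@within_continuous_cst R a b 0)).
  rewrite (_ : (fun s => (0 : 'M[R]_n) i j) = fun=> 0); last by apply/funext => s; rewrite mxE.
  by apply: eq_is_primitive => s _; rewrite Rintegral_cst// mul0r addr0.
- rewrite (_ : (fun s => (0 : 'M[R]_n) i j) = fun=> 0); last by apply/funext => s; rewrite mxE.
  exact: square_integrable_cst.
Qed.

(** The direct method. A minimizing sequence has bounded kinetic energy, hence is
    uniformly Hoelder and uniformly absolutely continuous, and so is each of its
    pointwise cluster points [g]. The discrete actions of [g] are at most the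
    infimum up to an error that vanishes with the mesh; Fatou's lemma bounds the
    kinetic energy of [g]. *)
Theorem action_minimizer_exists : exists g phi, admissible a b g phi /\
  forall h psi, admissible a b h psi -> action a b S g phi <= action a b S h psi.
Proof.
pose A := [set x | exists g phi, admissible a b g phi /\ x = action a b S g phi].
have lower g phi : admissible a b g phi -> - weight <= action a b S g phi.
  move=> adm; have := coupling_le cS adm; have := kinetic_ge0 a b phi.
  rewrite /action -/weight; lra.
have hA : has_inf A.
  split.
    exists (action a b S (fun=> 1%:M) (fun=> (0 : 'M[R]_n))), (fun=> 1%:M), (fun=> 0 : 'M[R]_n);
    split=> //; exact: admissible_id.
  by exists (- weight) => _ [g [phi [adm ->]]]; exact: lower.
have infA g phi : admissible a b g phi -> inf A <= action a b S g phi.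
  by move=> adm; apply: ge_inf; [case: hA|exists g, phi].
have /choice[G HG] : forall m : nat, exists gp : (R -> 'M[R]_n) * (R -> 'M[R]_n),
    admissible a b gp.1 gp.2 /\ action a b S gp.1 gp.2 < inf A + m.+1%:R^-1.
  move=> m; have m0 : 0 < m.+1%:R^-1 :> R by rewrite invr_gt0.
  have [_ [g [phi [adm ->]]] lt] := inf_adherent m0 hA.
  by exists (g, phi).
pose C := 2 * (inf A + 1 + weight).
have kinC m : kinetic a b (G m).2 <= C.
  have [adm lt] := HG m; have := coupling_le cS adm; rewrite -/weight.
  have : m.+1%:R^-1 <= 1 :> R by rewrite invf_le1// ler1n.
  by move: lt; rewrite /action /C; move: (m.+1%:R^-1) => r; lra.
pose x m := of_mx (G m).1.
have [p Hp] : exists p : cube, forall Phi : cube -> R, continuous Phi ->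
    forall e, 0 < e -> forall m0, exists2 m, (m0 <= m)%N & `|Phi (x m) - Phi p| < e.
  apply: (@pointwise_cluster _ _ x 1) => m [s [i j]]; rewrite /x /of_mx/=.
  apply: orthogonal_entry_le1; have [[+ _ _] _] := HG m; apply.
  by rewrite in_itv/= clamp_ge clamp_le// ltW.
have cluster_le (Phi : cube -> R) (c : R) m0 : continuous Phi -> (forall m, (m0 <= m)%N -> Phi (x m) <= c) ->
    Phi p <= c.
  move=> cPhi H; apply/ler_addgt0Pr => e e0.
  have [m m0m] := Hp Phi cPhi e e0 m0.
  by rewrite distrC => /(le_lt_trans (ler_norm _)); have := H m m0m; lra.
pose g := mx_of p.
have xE m s i j : s \in `[a, b] -> x m (s, (i, j)) = (G m).1 s i j by exact: of_mxE.
have og s : s \in `[a, b] -> orthogonal_group n (g s).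
  move=> sab; apply/matrixP => i j; rewrite !mxE.
  pose Phi (y : cube) := \sum_k y (s, (k, i)) * y (s, (k, j)).
  have cPhi : continuous Phi.
    by apply: continuous_sum => k; apply: continuousMc; exact: ccoord.
  have PhiE m : Phi (x m) = (i == j)%:R.
    have [[/(_ s sab) /matrixP/(_ i j) + _ _] _] := HG m; rewrite !mxE => <-.
    by apply: eq_bigr => k _; rewrite !xE// mxE.
  have -> : \sum_k (g s)^T i k * g s k j = Phi p.
    by apply: eq_bigr => k _; rewrite !mxE.
  apply/eqP; rewrite eq_le; apply/andP; split.
    by apply: (cluster_le Phi _ 0%N) => // m _; rewrite PhiE.
  rewrite -lerN2 -[leLHS]sub0r; apply: (cluster_le (fun y => 0 - Phi y) _ 0%N) => [|m _]; last first.
    by rewrite PhiE sub0r.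
  by apply: continuousBc => //; exact: continuous_cstc.
have ccont i j u v : continuous (fun y : cube => y (v, (i, j)) - y (u, (i, j))).
  by apply: continuousBc; exact: ccoord.
have gE s i j : g s i j = p (s, (i, j)) by rewrite mxE.
have acg i j : abs_continuous_on a b (fun s => g s i j).
  move=> e e0; have [d d0 H] := bounded_kinetic_ac n a b C (divr_gt0 e0 (ltr0n R 2)).
  exists d => // m u v uv tI len.
  apply: (@le_lt_trans _ _ (e / 2)); last by rewrite ltr_pdivrMr// ltr_pMr// ltr1n.
  under eq_bigr do rewrite !gE.
  apply: (cluster_le (fun y => \sum_(l < m) `|y (v l, (i, j)) - y (u l, (i, j))|) _ 0%N).
    by apply: continuous_sum => l; apply: continuous_normc; exact: ccont.
  move=> N _; have [adm _] := HG N.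
  have := H _ _ adm (kinC N) i j m u v uv tI len; apply: le_trans.
  rewrite le_eqVlt; apply/orP; left; apply/eqP/eq_bigr => l _.
  have [au [ul vb]] := uv l.
  by rewrite !xE// in_itv/= ?au ?vb ?(le_trans ul)// (le_trans au).
have hg i j u v : a <= u -> u <= v -> v <= b -> (g v i j - g u i j) ^+ 2 <= C * (v - u).
  move=> au uv vb; rewrite !gE.
  apply: (cluster_le (fun y => (y (v, (i, j)) - y (u, (i, j))) ^+ 2) _ 0%N).
    exact: continuous_sqrc.
  move=> N _; have [adm _] := HG N.
  rewrite !xE ?in_itv/= ?au ?vb ?(le_trans uv)// ?(le_trans au)//.
  apply: (le_trans (admissible_hoelder i j adm au uv vb)).
  by rewrite ler_wpM2r ?subr_ge0.
have /choice[F HF] : forall ij : 'I_n * 'I_n, exists f : R -> R,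
    is_primitive a b f (fun s => g s ij.1 ij.2).
  by move=> ij; exact: ac_primitive.
pose phi s : 'M[R]_n := \matrix_(i, j) F (i, j) s.
have phiE i j : (fun s => phi s i j) = F (i, j) by apply/funext => s; rewrite mxE.
have pg i j : is_primitive a b (fun s => phi s i j) (fun s => g s i j).
  by rewrite phiE; exact: (HF (i, j)).
have cg i j : {within `[a, b], continuous (fun s => g s i j)}.
  exact: (ac_continuous (acg i j)).
(* Twice the Riemann sum error of [e / 8] and the gap [1 / m.+1 < e / 8] to the
   infimum, doubled because of the factor [1 / 2] of the kinetic energy. *)
have key e : 0 < e -> \forall N \near \oo,
    \sum_(ij : 'I_n * 'I_n) discrete_energy a b (fun s => g s ij.1 ij.2) N <=
    2 * (inf A + coupling a b S g) + e.
  move=> e0; have e80 : 0 < e / 8 by rewrite divr_gt0.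
  have := discrete_coupling_cvg C e80; apply: filterS => N close.
  have cg' := close g cg hg.
  have [m0 _ Hm0] := near_infty_natSinv_lt (PosNum e80).
  have : discrete_action N p <= inf A + e / 4.
    apply: (cluster_le _ _ m0) => // m m0m; have [adm lt] := HG m.
    rewrite (discrete_actionE N (fun s i j => @xE m s i j)).
    have cm := close (G m).1 (fun i j => @admissible_continuous _ _ _ _ _ _ i j adm).
    have {}cm : `|coupling a b S (G m).1 - discrete_coupling a b S (G m).1 N| <= e / 8.
      apply: cm => i j u v au uv vb.
      apply: (le_trans (admissible_hoelder i j adm au uv vb)).
      by rewrite ler_wpM2r ?subr_ge0.
    have := kinetic_discrete_energy_le ab N adm.
    move: cm; rewrite ler_norml => /andP[c1 c2].
    have : m.+1%:R^-1 < e / 8 by exact: Hm0.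
    move: lt; rewrite /action; move: (m.+1%:R^-1) => r; lra.
  rewrite (discrete_actionE (g := g) N); last by move=> s i j _; rewrite gE.
  move: cg'; rewrite ler_norml => /andP[c1 c2]; lra.
have [sg kin] := discrete_energy_fatou ab (fun ij => pg ij.1 ij.2) key.
exists g, phi; split.
  by split=> // i j; exact: (sg (i, j)).
move=> h psi adm; apply: le_trans (infA _ _ adm).
by rewrite /action; move: kin; rewrite -/(kinetic a b phi); lra.
Qed.

End Existence.
(** * Algebra of primitives and trigonometric bounds *)

Section PrimitiveAlgebra.
Context {R : realType}.
Notation mu := (@lebesgue_measure R).
Variables (a b : R).
Hypothesis ab : a < b.
Implicit Types (f g phi psi : R -> R).

Lemma is_primitiveD phi psi f g : is_primitive a b phi f ->
  is_primitive a b psi g ->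
  is_primitive a b (fun t => phi t + psi t) (fun t => f t + g t).
Proof.
move=> [ip Hf] [iq Hg]; split; first exact: (integrableD _ ip iq).
move=> s as_ sb; rewrite (Hf s as_ sb) (Hg s as_ sb) RintegralD//; first by ring.
  exact: integrable_sub ip.
exact: integrable_sub iq.
Qed.

Lemma is_primitive_cst (c : R) : is_primitive a b (fun=> 0) (fun=> c).
Proof.
split; first exact/within_continuous_integrable/within_continuous_cst.
by move=> s _ _; rewrite Rintegral_cst// mul0r addr0.
Qed.

Lemma is_primitiveZ (c : R) phi f : is_primitive a b phi f ->
  is_primitive a b (fun t => c * phi t) (fun t => c * f t).
Proof.
move=> [ip Hf]; split; first exact: (integrableZl _ c ip).
move=> s as_ sb; rewrite (Hf s as_ sb) RintegralZl//; first by ring.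
exact: integrable_sub ip.
Qed.

Lemma is_primitive_sum (I : Type) (r : seq I) (phi f : I -> R -> R) :
  (forall i, is_primitive a b (phi i) (f i)) ->
  is_primitive a b (fun t => \sum_(i <- r) phi i t) (fun t => \sum_(i <- r) f i t).
Proof.
move=> H; elim: r => [|i r IH].
  have E (F : I -> R -> R) : (fun t => \sum_(i <- [::]) F i t) = fun=> 0.
    by apply/funext => t; rewrite big_nil.
  by rewrite !E; exact: is_primitive_cst.
have E (F : I -> R -> R) : (fun t => \sum_(j <- i :: r) F j t) =
    fun t => F i t + \sum_(j <- r) F j t.
  by apply/funext => t; rewrite big_cons.
by rewrite !E; exact: is_primitiveD.
Qed.

Lemma square_integrable_sum (I : Type) (r : seq I) (phi : I -> R -> R) :
  (forall i, square_integrable a b (phi i)) ->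
  square_integrable a b (fun t => \sum_(i <- r) phi i t).
Proof.
move=> H; elim: r => [|i r IH].
  rewrite (_ : (fun t => _) = fun=> 0); first exact: square_integrable_cst.
  by apply/funext => t; rewrite big_nil.
rewrite (_ : (fun t => _) = fun t => phi i t + \sum_(j <- r) phi j t).
  exact: square_integrableD.
by apply/funext => t; rewrite big_cons.
Qed.

Lemma square_integral_eq0 phi : square_integrable a b phi ->
  \int[mu]_(s in `[a, b]) phi s ^+ 2 = 0 -> ae_eq mu `[a, b]%classic phi (fun=> 0).
Proof.
move=> [mp ip] H.
have m2 : measurable_fun `[a, b] (fun s => (phi s ^+ 2)%:E).
  by apply/measurable_EFinP; exact: measurable_funX.
have : (\int[mu]_(s in `[a, b]) `|(phi s ^+ 2)%:E| = 0)%E.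
  under eq_integral do rewrite gee0_abs ?lee_fin ?sqr_ge0//.
  by rewrite -[LHS]fineK ?[fine _]H//; exact: integrable_fin_num.
move/(ae_eq_integral_abs mu (measurable_itv _) m2); apply: ae_imply => s /[apply] /= [[]].
by move/eqP; rewrite expf_eq0/= => /eqP.
Qed.

End PrimitiveAlgebra.

Lemma sin_dist_le {R : realType} (x y : R) : `|sin x - sin y| <= `|x - y|.
Proof.
wlog xy : x y / x <= y => [H|].
  by have [/H//|/ltW/H] := leP x y; rewrite distrC (distrC y).
have [c _ E] := MVT_segment xy (fun z _ => is_derive_sin z)
  (continuous_subspaceT (@continuous_sin R)).
rewrite distrC E normrM (distrC x) ler_piMl//.
by rewrite ler_norml cos_geN1 cos_le1.
Qed.

Lemma cos_dist_le {R : realType} (x y : R) : `|cos x - cos y| <= `|x - y|.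
Proof.
wlog xy : x y / x <= y => [H|].
  by have [/H//|/ltW/H] := leP x y; rewrite distrC (distrC y).
have [c _ E] := MVT_segment xy (fun z _ => is_derive_cos z)
  (continuous_subspaceT (@continuous_cos R)).
rewrite distrC E normrM (distrC x) ler_piMl// normrN.
by rewrite ler_norml sin_geN1 sin_le1.
Qed.

Lemma one_sub_cos_le {R : realType} (x : R) : `|1 - cos x| <= x ^+ 2.
Proof.
wlog x0 : x / 0 <= x => [H|].
  have [/H//|/ltW x0] := leP 0 x.
  by rewrite -cosN -sqrrN; apply: H; rewrite oppr_ge0.
have [c + E] := MVT_segment x0 (fun z _ => is_derive_cos z)
  (continuous_subspaceT (@continuous_cos R)).
rewrite in_itv/= => /andP[c0 cx].
rewrite distrC -(cos0 R) E subr0 normrM normrN expr2 (ger0_norm x0) ler_wpM2r//.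
by have := sin_dist_le c 0; rewrite sin0 !subr0 (ger0_norm c0) => /le_trans; apply.
Qed.

Lemma sin_sub_le {R : realType} (x : R) : `|sin x - x| <= x ^+ 2.
Proof.
wlog x0 : x / 0 <= x => [H|].
  have [/H//|/ltW x0] := leP 0 x.
  have := H (- x); rewrite oppr_ge0 sinN sqrrN => /(_ x0).
  by rewrite -normrN opprD !opprK.
have [c + E] := MVT_segment x0 (fun z _ => is_derive_sin z)
  (continuous_subspaceT (@continuous_sin R)).
rewrite in_itv/= => /andP[c0 cx].
rewrite -[sin x](subr0) -(sin0 R) E subr0 -[X in _ - X]mul1r -mulrBl.
rewrite normrM (ger0_norm x0) expr2 ler_wpM2r// distrC.
have := cos_dist_le 0 c; rewrite cos0 sub0r normrN (ger0_norm c0) => /le_trans; exact.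
Qed.
(** * Variation by rotations *)

Section InnerProduct.
Context {R : realType} (n : nat).
Implicit Types X Y Z Q : 'M[R]_n.

Lemma inner_oC X Y : inner_o X Y = inner_o Y X.
Proof. by rewrite !inner_o_pairE; apply: eq_bigr => ij _; rewrite mulrC. Qed.

Lemma inner_oDl X Y Z : inner_o (X + Y) Z = inner_o X Z + inner_o Y Z.
Proof.
by rewrite !inner_o_pairE -big_split; apply: eq_bigr => ij _; rewrite mxE mulrDl.
Qed.

Lemma inner_oZl (c : R) X Z : inner_o (c *: X) Z = c * inner_o X Z.
Proof.
by rewrite !inner_o_pairE mulr_sumr; apply: eq_bigr => ij _; rewrite mxE mulrA.
Qed.

Lemma inner_oDr X Y Z : inner_o Z (X + Y) = inner_o Z X + inner_o Z Y.
Proof. by rewrite inner_oC inner_oDl !(inner_oC Z). Qed.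

Lemma inner_oZr (c : R) X Z : inner_o Z (c *: X) = c * inner_o Z X.
Proof. by rewrite inner_oC inner_oZl (inner_oC Z). Qed.

Lemma inner_o_mull Q X Y : Q^T *m Q = 1%:M ->
  inner_o (Q *m X) (Q *m Y) = inner_o X Y.
Proof. by move=> oQ; rewrite /inner_o trmx_mul -mulmxA (mulmxA _ Q) oQ mul1mx. Qed.

Lemma inner_o_mulr Q X Y : Q^T *m Q = 1%:M ->
  inner_o (X *m Q) (Y *m Q) = inner_o X Y.
Proof.
move=> /mulmx1C oQ.
by rewrite /inner_o trmx_mul mxtrace_mulC !mulmxA -(mulmxA Y) oQ mulmx1 mxtrace_mulC.
Qed.

Lemma inner_o_trmul Q X Y : inner_o X (Q *m Y) = inner_o (Q^T *m X) Y.
Proof. by rewrite /inner_o trmx_mul trmxK mulmxA. Qed.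

(** The exponential of [t W] when [W^3 = - W], as for the generator of the
    rotations in a coordinate plane. *)
Definition rot (W : 'M[R]_n) (t : R) : 'M[R]_n :=
  1%:M + sin t *: W + (1 - cos t) *: (W *m W).

Definition skew_unit (W : 'M[R]_n) := W^T = - W /\ W *m (W *m W) = - W.

(** This is the derivative of [rot W] at [t]. *)
Lemma mul_rot W t : skew_unit W -> W *m rot W t = cos t *: W + sin t *: (W *m W).
Proof.
move=> [_ W3]; rewrite /rot !mulmxDr mulmx1 -!scalemxAr W3.
by apply/matrixP => i j; rewrite !mxE; ring.
Qed.

Lemma rot_orthogonal W t : skew_unit W -> (rot W t)^T *m rot W t = 1%:M.
Proof.
move=> skW; have [WT W3] := skW.
have -> : (rot W t)^T = 1%:M + (- sin t) *: W + (1 - cos t) *: (W *m W).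
  rewrite /rot !linearD/= !linearZ/= trmx1 trmx_mul WT mulNmx mulmxN opprK.
  by rewrite scalerN scaleNr.
rewrite !mulmxDl mul1mx -!scalemxAl -(mulmxA W W) mul_rot// mulmxDr -!scalemxAr W3.
rewrite /rot; move: (W *m W) => W2.
have cs : cos t ^+ 2 = 1 - sin t ^+ 2 by rewrite -(cos2Dsin2 t); ring.
apply/matrixP => i j; rewrite !mxE; apply/eqP; rewrite -subr_eq0; apply/eqP.
transitivity ((1 - sin t ^+ 2 - cos t ^+ 2) * W2 i j); first by ring.
by rewrite cs; ring.
Qed.

End InnerProduct.

Section Variation.
Context {R : realType} (n : nat).
Notation mu := (@lebesgue_measure R).
Variables (a b : R) (S : R -> 'M[R]_n).
Hypothesis ab : a < b.
Hypothesis cS : forall i j, {within `[a, b], continuous (fun s => S s i j)}.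
Implicit Types (g phi : R -> 'M[R]_n) (zeta eta : R -> R).

Lemma is_primitive_ext (phi psi f g : R -> R) : (forall s, phi s = psi s) ->
  (forall s, f s = g s) -> is_primitive a b phi f -> is_primitive a b psi g.
Proof. by move=> /funext -> /funext ->. Qed.

Lemma within_continuous_mulmx (A B : R -> 'M[R]_n) :
  (forall i j, {within `[a, b], continuous (fun s => A s i j)}) ->
  (forall i j, {within `[a, b], continuous (fun s => B s i j)}) ->
  forall i j, {within `[a, b], continuous (fun s => (A s *m B s) i j)}.
Proof.
move=> cA cB i j.
apply: (@eq_within_continuous _ _ _ (fun s => \sum_k A s i k * B s k j)).
  by move=> s _; rewrite mxE.
by apply: within_continuous_sum => k; exact: within_continuousM.
Qed.

Lemma kineticE phi : (forall i j, square_integrable a b (fun s => phi s i j)) ->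
  kinetic a b phi = \int[mu]_(s in `[a, b]) inner_o (phi s) (phi s).
Proof.
move=> sq; under [RHS]eq_Rintegral do rewrite inner_o_pairE.
rewrite Rintegral_sum => [|ij]; last exact: square_integrableM.
by apply: eq_bigr => ij _; apply: eq_Rintegral => s _; rewrite expr2.
Qed.

Variables (g phi : R -> 'M[R]_n) (W : 'M[R]_n) (zeta eta : R -> R).
Hypothesis adm : admissible a b g phi.
Hypothesis skW : skew_unit W.
Hypothesis szeta : square_integrable a b zeta.
Hypothesis peta : is_primitive a b zeta eta.

Definition variation_curve (e s : R) := g s *m rot W (e * eta s).

(** The derivative of [variation_curve e], by [mul_rot]. *)
Definition variation_velocity (e s : R) := phi s *m rot W (e * eta s) +
  (e * zeta s) *: (g s *m (W *m rot W (e * eta s))).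

Let is_primitive_rot e k j : is_primitive a b
  (fun s => (e * zeta s) * (W *m rot W (e * eta s)) k j)
  (fun s => rot W (e * eta s) k j).
Proof.
have pe := is_primitiveZ e peta.
have psin := is_primitive_comp (C := 1) ab pe
  (fun x y => eq_ind_r (fun z => `|sin x - sin y| <= z) (sin_dist_le x y) (mul1r _))
  (@is_derive_sin R) (@continuous_cos R).
have cNsin : continuous (fun x : R => - sin x).
  by move=> x; apply: cvgN; exact: continuous_sin.
have pcos := is_primitive_comp (C := 1) ab pe
  (fun x y => eq_ind_r (fun z => `|cos x - cos y| <= z) (cos_dist_le x y) (mul1r _))
  (@is_derive_cos R) cNsin.
have := is_primitiveD (is_primitive_cst a b ((1%:M + W *m W) k j))
  (is_primitiveD (is_primitiveZ (W k j) psin) (is_primitiveZ (- (W *m W) k j) pcos)).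
apply: is_primitive_ext => s; last first.
  by rewrite /rot; move: (W *m W) => W2; rewrite !mxE; ring.
by rewrite mul_rot//; move: (W *m W) => W2; rewrite !mxE; ring.
Qed.

Let continuous_rot e i j : {within `[a, b], continuous (fun s => rot W (e * eta s) i j)}.
Proof. exact: is_primitive_continuous (is_primitive_rot e i j). Qed.

Let cg i j : {within `[a, b], continuous (fun s => g s i j)}.
Proof. exact: admissible_continuous adm. Qed.

Let continuous_cmx (A : 'M[R]_n) i j : {within `[a, b], continuous (fun=> A i j)}.
Proof. exact: within_continuous_cst. Qed.

Let velocityE e s i j : variation_velocity e s i j =
  \sum_k phi s i k * rot W (e * eta s) k j +
  (e * zeta s) * (g s *m (W *m rot W (e * eta s))) i j.
Proof. by rewrite /variation_velocity mxE [X in X + _]mxE [X in _ + X]mxE. Qed.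

Lemma variation_admissible e :
  admissible a b (variation_curve e) (variation_velocity e).
Proof.
have [og pg sg] := adm; split=> [s sab|i j|i j].
- rewrite /orthogonal_group/= /variation_curve trmx_mul -mulmxA (mulmxA _ (g s)).
  by have /= -> := og s sab; rewrite mul1mx rot_orthogonal.
- have := is_primitive_sum (index_enum _)
    (fun k : 'I_n => is_primitiveM ab (pg i k) (is_primitive_rot e k j)).
  apply: is_primitive_ext => s; last by rewrite /variation_curve mxE.
  rewrite velocityE [X in _ = _ + _ * X]mxE big_split/= mulr_sumr.
  under [X in _ + X = _]eq_bigr do rewrite mulrCA.
  by congr (_ + _).
- rewrite (_ : (fun s => _) = fun s => \sum_k rot W (e * eta s) k j * phi s i k +
      (g s *m (W *m rot W (e * eta s))) i j * (e * zeta s)).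
    apply: square_integrableD.
      by apply: square_integrable_sum => k; exact: continuous_square_integrableM.
    apply: continuous_square_integrableM; first exact: square_integrableZ.
    by do 2!apply: within_continuous_mulmx => //.
  apply/funext => s; rewrite velocityE [X in _ + X = _]mulrC.
  under [X in X + _ = _]eq_bigr do rewrite mulrC.
  by congr (_ + _).
Qed.

End Variation.
(** * The Euler-Lagrange equation of the action *)

Lemma square_integrable_inner_o {R : realType} (n : nat) (a b : R)
    (phi psi : R -> 'M[R]_n) :
  (forall i j, square_integrable a b (fun s => phi s i j)) ->
  (forall i j, square_integrable a b (fun s => psi s i j)) ->
  (@lebesgue_measure R).-integrable `[a, b] (EFin \o (fun s => inner_o (phi s) (psi s))).
Proof.
move=> sp sq; rewrite (_ : _ \o _ = fun s =>
    (\sum_(ij : 'I_n * 'I_n) (phi s ij.1 ij.2 * psi s ij.1 ij.2)%:E)%E).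
  by apply: integrable_sum => // ij _; exact: square_integrableM.
by apply/funext => s /=; rewrite inner_o_pairE sumEFin.
Qed.

Section EulerLagrange.
Context {R : realType} (n : nat).
Notation mu := (@lebesgue_measure R).
Variables (a b : R) (S : R -> 'M[R]_n).
Hypothesis ab : a < b.
Hypothesis cS : forall i j, {within `[a, b], continuous (fun s => S s i j)}.
Variables (g phi : R -> 'M[R]_n).
Hypothesis adm : admissible a b g phi.
Hypothesis gmin : forall h psi, admissible a b h psi ->
  action a b S g phi <= action a b S h psi.

Let cg i j : {within `[a, b], continuous (fun s => g s i j)}.
Proof. exact: admissible_continuous adm. Qed.

Let continuous_gW (A : 'M[R]_n) i j : {within `[a, b], continuous (fun s => (g s *m A) i j)}.
Proof.
apply: (@within_continuous_mulmx _ _ a b g (fun=> A)) => // k l.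
exact: within_continuous_cst.
Qed.

Let continuous_gWS (A : 'M[R]_n) :
  {within `[a, b], continuous (fun s => inner_o (g s *m A) (S s))}.
Proof. exact: continuous_inner_o. Qed.

Let square_integrable_momentum (A : 'M[R]_n) :
  square_integrable a b (fun s => inner_o (phi s) (g s *m A)).
Proof.
have [_ _ sg] := adm.
rewrite (_ : (fun s => _) = fun s =>
    \sum_(ij : 'I_n * 'I_n) (g s *m A) ij.1 ij.2 * phi s ij.1 ij.2).
  by apply: square_integrable_sum => ij; exact: continuous_square_integrableM.
by apply/funext => s; rewrite inner_oC inner_o_pairE.
Qed.

Section FirstVariation.
Variables (W : 'M[R]_n) (zeta eta : R -> R).
Hypothesis skW : skew_unit W.
Hypothesis szeta : square_integrable a b zeta.
Hypothesis peta : is_primitive a b zeta eta.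

Let p s := inner_o (phi s) (g s *m W).
Let m1 s := inner_o (g s *m W) (S s).
Let m2 s := inner_o (g s *m (W *m W)) (S s).

Let ceta : {within `[a, b], continuous eta}.
Proof. exact: is_primitive_continuous peta. Qed.

Let ig (f : R -> R) : {within `[a, b], continuous f} ->
  mu.-integrable `[a, b] (EFin \o f).
Proof. exact: within_continuous_integrable. Qed.

Let iZ (c : R) (f : R -> R) : mu.-integrable `[a, b] (EFin \o f) ->
  mu.-integrable `[a, b] (EFin \o (fun s => c * f s)).
Proof. by move=> /(integrableZl _ c); exact. Qed.

Let iD (f f' : R -> R) : mu.-integrable `[a, b] (EFin \o f) ->
  mu.-integrable `[a, b] (EFin \o f') ->
  mu.-integrable `[a, b] (EFin \o (fun s => f s + f' s)).
Proof. by move=> i1 i2; exact: (integrableD _ i1 i2). Qed.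

(** Exactly quadratic in [e]: the rotation acts isometrically on the velocity. *)
Let kinetic_variation e : kinetic a b (variation_velocity g phi W zeta eta e) =
  kinetic a b phi + (2 * e) * (\int[mu]_(s in `[a, b]) (zeta s * p s)) +
  (e ^+ 2 * inner_o W W) * (\int[mu]_(s in `[a, b]) zeta s ^+ 2).
Proof.
have [og _ sg] := adm.
have [_ _ sv] := variation_admissible ab adm skW szeta peta e.
have i1 := square_integrable_inner_o sg sg.
have i2 := square_integrableM szeta (square_integrable_momentum W).
have i3 : mu.-integrable `[a, b] (EFin \o (fun s => zeta s ^+ 2)) := szeta.2.
have i2z := iZ (2 * e) i2; have i3z := iZ (e ^+ 2 * inner_o W W) i3.
have i12 := iD i1 i2z.
rewrite !kineticE// -!RintegralZl// -!RintegralD//.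
apply: eq_Rintegral => s; rewrite inE => sab.
have gog : (g s)^T *m g s = 1%:M by exact: og.
rewrite /variation_velocity (mulmxA (g s)) scalemxAl -mulmxDl.
rewrite inner_o_mulr; last exact: rot_orthogonal.
rewrite inner_oDl !inner_oDr !inner_oZl !inner_oZr inner_o_mull//.
rewrite (inner_oC (g s *m W) (phi s)) -/(p s); ring.
Qed.

(** Up to second order, [sin x] is [x] and [cos x] is 1. *)
Let coupling_variation e : coupling a b S g +
  e * (\int[mu]_(s in `[a, b]) (eta s * m1 s)) -
  e ^+ 2 * (\int[mu]_(s in `[a, b]) (eta s ^+ 2 * (`|m1 s| + `|m2 s|))) <=
  coupling a b S (variation_curve g W eta e).
Proof.
have i0 := ig (continuous_inner_o cS cg).
have i1 : mu.-integrable `[a, b] (EFin \o (fun s => eta s * m1 s)).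
  by apply/ig/within_continuousM => //; exact: continuous_gWS.
have i2 : mu.-integrable `[a, b] (EFin \o (fun s => eta s ^+ 2 * (`|m1 s| + `|m2 s|))).
  apply/ig/within_continuousM.
    apply: (@eq_within_continuous _ _ _ (fun s => eta s * eta s)).
      by move=> s _; rewrite expr2.
    exact: within_continuousM.
  by apply: within_continuousD; apply: within_continuous_norm; exact: continuous_gWS.
have iv : mu.-integrable `[a, b]
    (EFin \o (fun s => inner_o (variation_curve g W eta e s) (S s))).
  apply/ig/continuous_inner_o => // i j.
  exact: admissible_continuous (variation_admissible ab adm skW szeta peta e).
have i1z := iZ e i1; have i2z := iZ (- e ^+ 2) i2; have i01 := iD i0 i1z.
rewrite -mulNr -!RintegralZl// -!RintegralD//.
apply: le_Rintegral => //; first exact: iD.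
move=> s _; rewrite /variation_curve /rot !mulmxDr mulmx1 -!scalemxAr.
rewrite !inner_oDl !inner_oZl -/(m1 s) -/(m2 s).
set x := e * eta s.
have s1 : `|(sin x - x) * m1 s| <= x ^+ 2 * `|m1 s|.
  by rewrite normrM ler_wpM2r// sin_sub_le.
have s2 : `|(1 - cos x) * m2 s| <= x ^+ 2 * `|m2 s|.
  by rewrite normrM ler_wpM2r// one_sub_cos_le.
move: s1 s2; rewrite !ler_norml => /andP[s1 _] /andP[s2 _].
have -> : e * (eta s * m1 s) = x * m1 s by rewrite /x mulrA.
have -> : - e ^+ 2 * (eta s ^+ 2 * (`|m1 s| + `|m2 s|)) =
    - (x ^+ 2 * `|m1 s|) - x ^+ 2 * `|m2 s| by rewrite /x; ring.
by move: s1; rewrite mulrBl; lra.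
Qed.

(** The action along the variation is at most a quadratic polynomial in [e] that
    takes the minimal value at [e = 0]; its linear coefficient vanishes. *)
Lemma first_variation :
  \int[mu]_(s in `[a, b]) (zeta s * p s) = \int[mu]_(s in `[a, b]) (eta s * m1 s).
Proof.
set I1 := LHS; set I3 := RHS.
pose I2 := \int[mu]_(s in `[a, b]) zeta s ^+ 2.
pose I4 := \int[mu]_(s in `[a, b]) (eta s ^+ 2 * (`|m1 s| + `|m2 s|)).
pose K := 2^-1 * (inner_o W W * I2) + I4.
have K0 : 0 <= K.
  rewrite addr_ge0 ?mulr_ge0//.
  - by rewrite inner_o_pairE sumr_ge0// => ij _; rewrite -expr2 sqr_ge0.
  - by apply: Rintegral_ge0 => s _; exact: sqr_ge0.
  - by apply: Rintegral_ge0 => s _; rewrite mulr_ge0 ?sqr_ge0 ?addr_ge0.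
have H e : 0 <= e * (I1 - I3) + e ^+ 2 * K.
  have := gmin (variation_admissible ab adm skW szeta peta e).
  have := coupling_variation e; rewrite -/I3 -/I4.
  rewrite /action kinetic_variation -/I1 -/I2 /K.
  set k := kinetic a b phi; set c := coupling a b S g.
  set c' := coupling _ _ _ _ => h1 h2; nra.
apply/eqP; rewrite -subr_eq0; apply/negPn/negP => D0.
have K1 : 0 < 1 + K by lra.
(* The polynomial is negative at this point unless [I1 = I3]. *)
have := H (- (I1 - I3) / (1 + K)).
rewrite leNgt => /negP; apply.
have -> : - (I1 - I3) / (1 + K) * (I1 - I3) + (- (I1 - I3) / (1 + K)) ^+ 2 * K =
   - ((I1 - I3) / (1 + K)) ^+ 2 by field; rewrite gt_eqF.
rewrite oppr_lt0 exprn_even_gt0//= mulf_neq0// invr_neq0//.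
by rewrite gt_eqF.
Qed.

End FirstVariation.

(** The integrated Euler-Lagrange equation in the direction [W]; the right-hand side
    vanishes at both ends, since the end points of the curve are free. The test
    direction [zeta] is the difference of the two sides: after an integration by
    parts the first variation says that [zeta] is orthogonal to itself. *)
Lemma momentum_ae (W : 'M[R]_n) : skew_unit W -> ae_eq mu `[a, b]%classic
  (fun s => inner_o (phi s) (g s *m W))
  (fun s => \int[mu]_(t in `[a, b]) inner_o (g t *m W) (S t) -
            \int[mu]_(t in `[a, s]) inner_o (g t *m W) (S t)).
Proof.
move=> skW; pose m s := inner_o (g s *m W) (S s).
pose p s := inner_o (phi s) (g s *m W).
pose F s := \int[mu]_(t in `[a, b]) m t - \int[mu]_(t in `[a, s]) m t.
have im : mu.-integrable `[a, b] (EFin \o m).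
  by apply: within_continuous_integrable; exact: continuous_gWS.
have pF : is_primitive a b (fun s => - m s) F.
  have := is_primitiveB (is_primitive_cst a b (\int[mu]_(t in `[a, b]) m t))
    (is_primitive_integral 0 im).
  by apply: is_primitive_ext => s; rewrite ?sub0r ?add0r.
have sF : square_integrable a b F.
  by apply: continuous_square_integrable; exact: is_primitive_continuous pF.
have sp : square_integrable a b p by exact: square_integrable_momentum.
pose zeta s := p s + (-1) * F s.
have szeta : square_integrable a b zeta.
  by apply: square_integrableD => //; exact: square_integrableZ.
pose eta s := 0 + \int[mu]_(t in `[a, s]) zeta t.
have peta : is_primitive a b zeta eta.
  by apply: is_primitive_integral; exact: square_integrable_integrable.
have := first_variation skW szeta peta; rewrite -/(p _) -/(m _) => FV.
have leab := ltW ab.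
have izF := square_integrableM szeta sF.
have izp := square_integrableM szeta sp.
have iem : mu.-integrable `[a, b] (EFin \o (fun s => eta s * m s)).
  apply/within_continuous_integrable/within_continuousM.
    exact: is_primitive_continuous peta.
  exact: continuous_gWS.
have := is_primitive_itv (is_primitiveM ab peta pF) (lexx a) leab (lexx b).
have -> : F b = 0 by rewrite /F subrr.
have -> : eta a = 0 by rewrite /eta set_itv1 Rintegral_set1 addr0.
rewrite mulr0 mul0r subrr.
under eq_Rintegral do rewrite mulrN.
rewrite RintegralB// => /esym/eqP; rewrite subr_eq0 => /eqP parts.
have z0 : \int[mu]_(s in `[a, b]) zeta s ^+ 2 = 0.
  transitivity (\int[mu]_(s in `[a, b]) (zeta s * p s - zeta s * F s)).
    by apply: eq_Rintegral => s _; rewrite /zeta; ring.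
  by rewrite RintegralB// FV parts subrr.
apply: ae_imply (square_integral_eq0 szeta z0) => s H sab.
by have := H sab; rewrite /zeta mulN1r => /eqP; rewrite subr_eq0 => /eqP.
Qed.

Definition skew_basis (i j : 'I_n) : 'M[R]_n := delta_mx i j - delta_mx j i.

Lemma skew_basis_unit i j : skew_unit (skew_basis i j).
Proof.
rewrite /skew_basis; split; first by rewrite linearB/= !trmx_delta opprB.
have [->|ij] := eqVneq i j; first by rewrite subrr !mul0mx oppr0.
have ji : (j == i) = false by rewrite eq_sym (negbTE ij).
rewrite !(mulmxBl, mulmxBr) !mul_delta_mx_cond !eqxx ji (negbTE ij)/=.
rewrite ?mulr0n ?mulr1n ?mulmx0 ?mulmxN ?sub0r ?subr0 ?mulmxDr ?mulmxBr ?mulmxN.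
by rewrite !mul_delta_mx_cond !eqxx ji (negbTE ij)/= ?mulr0n ?mulr1n; apply/matrixP => k l;
   rewrite !mxE; ring.
Qed.

Lemma inner_o_skew_basis (X : 'M[R]_n) i j :
  inner_o X (skew_basis i j) = X i j - X j i.
Proof.
have D k l : inner_o X (delta_mx k l) = X k l.
  rewrite inner_o_pairE (bigD1 (k, l))//= mxE !eqxx mulr1 big1 ?addr0//.
  move=> [k' l'] /= ne; rewrite mxE; case: eqP => [E1|]; case: eqP => [E2|];
    rewrite ?mulr0//.
  by move: ne; rewrite E1 E2 eqxx.
by rewrite /skew_basis inner_oC -[X in _ = _ - X]D -D inner_oDl !(inner_oC X) -scaleN1r
   inner_oZl mulN1r.
Qed.

(** The candidate for [g^-1 g'], read off from [momentum_ae] in the coordinates of a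
    skew-symmetric matrix; unlike the derivative of [g] it is defined everywhere
    and continuously differentiable. *)
Definition body_velocity s : 'M[R]_n := \matrix_(i, j) (2^-1 *
  (\int[mu]_(t in `[a, b]) inner_o (g t *m skew_basis i j) (S t) -
   \int[mu]_(t in `[a, s]) inner_o (g t *m skew_basis i j) (S t))).

(** Differentiate [g^T g = 1]. *)
Lemma velocity_skew_ae : {ae mu, forall s, `[a, b]%classic s ->
  forall i j, ((g s)^T *m phi s) i j = - ((g s)^T *m phi s) j i}.
Proof.
have [og pg _] := adm.
have := ae_forall (fun ij : 'I_n * 'I_n =>
  is_primitive_derive_ae ab (pg ij.1 ij.2)).
apply: ae_imply => s H sab i j.
have D k l : has_derive_on a b (fun t => g t k l) s (phi s k l) by exact: (H (k, l) sab).
have D1 := has_derive_on_sum (r := index_enum _) (fun k : 'I_n => has_derive_onM (D k i) (D k j)).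
have D0 : has_derive_on a b (fun t => \sum_k g t k i * g t k j) s 0.
  apply: eq_has_derive_on (has_derive_on_cst a b ((i == j)%:R) s) => // t tab.
  have /matrixP/(_ i j) : (g t)^T *m g t = 1%:M by exact: og.
  by rewrite !mxE => <-; apply: eq_bigr => k _; rewrite mxE.
have := has_derive_on_unique ab sab D0 D1.
rewrite big_split/= => /esym/eqP; rewrite addrC addr_eq0 => /eqP E.
rewrite !mxE (eq_bigr (fun k => g s k i * phi s k j)); last by move=> k _; rewrite mxE.
by rewrite E; congr (- _); apply: eq_bigr => k _; rewrite mxE mulrC.
Qed.

Lemma velocity_ae : {ae mu, forall s, `[a, b]%classic s ->
  phi s = g s *m body_velocity s}.
Proof.
have [og _ _] := adm.
have := ae_forall (fun ij : 'I_n * 'I_n => momentum_ae (skew_basis_unit ij.1 ij.2)).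
apply: ae_imply2 velocity_skew_ae => s skew mom sab.
have gog : (g s)^T *m g s = 1%:M by exact: og.
rewrite -[phi s]mul1mx -(mulmx1C gog) -mulmxA; congr (_ *m _).
apply/matrixP => i j; rewrite [RHS]mxE -(mom (i, j) sab)/=.
rewrite inner_o_trmul inner_o_skew_basis (skew sab j i) opprK -mulr2n.
by rewrite -[X in _ * X]mulr_natl mulKf ?pnatr_eq0.
Qed.

Lemma body_velocity_primitive i j : is_primitive a b
  (fun s => - (2^-1 * inner_o (g s *m skew_basis i j) (S s)))
  (fun s => body_velocity s i j).
Proof.
have im : mu.-integrable `[a, b]
    (EFin \o (fun s => inner_o (g s *m skew_basis i j) (S s))).
  by apply: within_continuous_integrable; exact: continuous_gWS.
have := is_primitiveB (is_primitive_cst a b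
  (2^-1 * \int[mu]_(t in `[a, b]) inner_o (g t *m skew_basis i j) (S t)))
  (is_primitiveZ 2^-1 (is_primitive_integral 0 im)).
by apply: is_primitive_ext => s; rewrite ?sub0r// mxE add0r mulrBr.
Qed.

(** The derivative agrees almost everywhere with a continuous function, of which [g]
    is therefore a classical primitive. *)
Lemma minimizer_has_derive s : s \in `[a, b] ->
  has_derive_on a b g s (g s *m body_velocity s).
Proof.
move=> sab; have [_ pg _] := adm.
have cv i j : {within `[a, b], continuous (fun t => (g t *m body_velocity t) i j)}.
  apply: within_continuous_mulmx => // k l.
  exact: is_primitive_continuous (body_velocity_primitive k l).
apply/has_derive_on_mxP => i j.
apply: (@continuous_primitive_has_derive _ a b (fun t => (g t *m body_velocity t) i j)) => //.
apply: (is_primitive_ae _ _ (pg i j)); first exact: within_continuous_measurable.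
by apply: ae_imply velocity_ae => t H tab /=; rewrite {1}H.
Qed.

Lemma body_velocity_has_derive s : s \in `[a, b] -> has_derive_on a b body_velocity s
  (\matrix_(i, j) - (2^-1 * inner_o (g s *m skew_basis i j) (S s))).
Proof.
move=> sab; apply/has_derive_on_mxP => i j; rewrite mxE.
apply: (continuous_primitive_has_derive (body_velocity_primitive i j)) => //.
have /subspace_continuousP c := @continuous_gWS (skew_basis i j).
apply/subspace_continuousP => x xab; apply: cvgN; apply: cvgM; first exact: cvg_cst.
exact: c.
Qed.

End EulerLagrange.
(** * The matching energy *)

Lemma invmx_orthogonal {R : realType} (n : nat) (X : 'M[R]_n) :
  X^T *m X = 1%:M -> invmx X = X^T.
Proof.
move=> oX.
by rewrite -[RHS]mulmx1 -(mulmxV (mulmx1_unit oX).2) mulmxA oX mul1mx.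
Qed.

Section SobolevCurves.
Context {R : realType} (n : nat).
Notation mu := (@lebesgue_measure R).
Variables (a b : R).
Hypothesis ab : a < b.
Implicit Types (g phi : R -> 'M[R]_n).

Lemma Lfun2_square_integrable (f : R -> R) :
  (f \_ `[a, b] \in Lfun mu 2%:E) <-> square_integrable a b f.
Proof.
have sqE : (fun x => (f \_ `[a, b]) x ^+ 2) = (fun x => f x ^+ 2) \_ `[a, b].
  apply/funext => x; rewrite !patchE; case: ifP => // _.
  by rewrite expr0n.
split=> [H|[mf isq]].
  split.
    apply/(measurable_restrictT _ _).2 => //.
    by move: H; rewrite inE => /andP[]; rewrite inE.
  apply/(integrable_mkcond _ _).2 => //; rewrite restrict_EFin -sqE.
  exact: Lfun2_integrable_sqr.
have mr : measurable_fun setT (f \_ `[a, b]) by exact/(measurable_restrictT _ _).1.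
rewrite inE; apply/andP; split; first by rewrite inE.
rewrite inE/= /finite_norm unlock /Lnorm poweR_lty//.
have /integrableP[_] : mu.-integrable setT (EFin \o (fun x => (f \_ `[a, b]) x ^+ 2)).
  by rewrite sqE -restrict_EFin; apply/(integrable_mkcond _ _).1.
apply: le_lt_trans; rewrite le_eqVlt; apply/orP; left; apply/eqP/eq_integral => x _ /=.
by rewrite powR_mulrn// normrX.
Qed.

(** The derivative of an H^1 curve exists almost everywhere and is a density of the
    curve, so that the default values of [derive_on] are harmless. *)
Lemma H1_admissible g : H1_orthogonal a b g -> admissible a b g (derive_on a b g).
Proof.
move=> [og acg sg]; have sq i j := (Lfun2_square_integrable _).1 (sg i j).
have ac := (ac_mxP a b g).1 acg.
have /choice[F HF] : forall ij : 'I_n * 'I_n, exists f : R -> R,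
    is_primitive a b f (fun s => g s ij.1 ij.2).
  by move=> ij; exact: ac_primitive.
have := ae_forall (fun ij => is_primitive_derive_ae ab (HF ij)).
move=> ae; split=> // i j; apply: (is_primitive_ae _ _ (HF (i, j))); first exact: (sq i j).1.
apply: ae_imply ae => s H sab.
have D : has_derive_on a b g s (\matrix_(i, j) F (i, j) s).
  by apply/has_derive_on_mxP => k l; rewrite mxE; exact: (H (k, l) sab).
by have [_ ->] := has_derive_onE ab sab D; rewrite mxE.
Qed.

Lemma admissible_H1 g phi V : admissible a b g phi ->
  (forall s, s \in `[a, b] -> has_derive_on a b g s (V s)) ->
  (forall i j, {within `[a, b], continuous (fun s => V s i j)}) ->
  H1_orthogonal a b g.
Proof.
move=> [og pg _] dg cV; split=> //.
  by apply/ac_mxP => i j; exact: is_primitive_ac (pg i j).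
move=> i j; apply/Lfun2_square_integrable; apply: continuous_square_integrable.
apply: (@eq_within_continuous _ _ _ (fun s => V s i j)) => // s sab.
by have [_ ->] := has_derive_onE ab sab (dg s sab).
Qed.

Lemma admissible_kinetic_unique g phi psi : admissible a b g phi ->
  admissible a b g psi -> kinetic a b phi = kinetic a b psi.
Proof.
move=> [_ pg sg] [_ ph sh]; apply: eq_bigr => ij _; congr fine.
have mphi := (sg ij.1 ij.2).1; have mpsi := (sh ij.1 ij.2).1.
apply: ae_eq_integral => //.
- by apply/measurable_EFinP; exact: measurable_funX.
- by apply/measurable_EFinP; exact: measurable_funX.
have := is_primitive_derive_ae ab (ph ij.1 ij.2).
have := is_primitive_derive_ae ab (pg ij.1 ij.2).
apply: ae_imply2 => s H1 H2 sab.
by rewrite (has_derive_on_unique ab sab (H1 sab) (H2 sab)).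
Qed.

End SobolevCurves.

Section Energy.
Context {R : realType} (n k : nat).
Notation mu := (@lebesgue_measure R).
Variables (a b : R) (lam : 'rV[R]_k) (c1 c2 : R -> 'cV[R]_n).
Hypothesis ab : a < b.
Hypothesis Ck1 : Ck_on k a b c1.
Hypothesis Ck2 : Ck_on k a b c2.
Hypothesis lam_gt0 : forall i, 0 < lam 0 i.

Notation j1 := (jet k a b c1).
Notation j2 := (jet k a b c2).

(** The matrix representing [G |-> <G j1, j2>_L] in the inner product of matrices,
    see [inner_L_source]. *)
Definition source s : 'M[R]_n := j2 s *m diag_mx lam *m (j1 s)^T.

Lemma inner_LE (A B : 'M[R]_(n, k)) :
  inner_L lam A B = \sum_j lam 0 j * \sum_i A i j * B i j.
Proof.
rewrite /inner_L /mxtrace; apply: eq_bigr => j _.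
rewrite mul_diag_mx mxE mulr_sumr; apply: eq_bigr => i _.
by rewrite !mxE mulrA.
Qed.

Lemma inner_L_ge0 (A : 'M[R]_(n, k)) : 0 <= inner_L lam A A.
Proof.
rewrite inner_LE sumr_ge0// => j _; apply: mulr_ge0; first exact: ltW.
by apply: sumr_ge0 => i _; rewrite -expr2 sqr_ge0.
Qed.

Lemma inner_L_mull (G : 'M[R]_n) (A B : 'M[R]_(n, k)) : G^T *m G = 1%:M ->
  inner_L lam (G *m A) (G *m B) = inner_L lam A B.
Proof. by move=> oG; rewrite /inner_L trmx_mul -!mulmxA (mulmxA G^T) oG mul1mx. Qed.

Lemma inner_L_source (G : 'M[R]_n) s :
  inner_L lam (G *m j1 s) (j2 s) = inner_o G (source s).
Proof.
rewrite /inner_L /inner_o /source trmx_mul.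
rewrite mxtrace_mulC !mulmxA mxtrace_mulC !mulmxA.
by rewrite mxtrace_mulC !mulmxA.
Qed.

Lemma jet_continuous (c : R -> 'cV[R]_n) i j : Ck_on k a b c ->
  {within `[a, b], continuous (fun s => jet k a b c s i j)}.
Proof.
move=> [_ cc].
apply: (@eq_within_continuous _ _ _ (fun s => derive_onn a b j.+1 c s i 0)).
  by move=> s _; rewrite mxE.
have /subspace_continuousP C := cc j.+1 (ltn_ord j).
apply/subspace_continuousP => x xab.
apply/cvgrPdist_le => e e0; have /cvgrPdist_le/(_ e e0) := C x xab.
apply: filterS => t H; apply: le_trans H.
have := mx_norm_entry_le (derive_onn a b j.+1 c x - derive_onn a b j.+1 c t) i 0.
by rewrite !mxE.
Qed.

Lemma inner_L_continuous (A B : R -> 'M[R]_(n, k)) :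
  (forall i j, {within `[a, b], continuous (fun s => A s i j)}) ->
  (forall i j, {within `[a, b], continuous (fun s => B s i j)}) ->
  {within `[a, b], continuous (fun s => inner_L lam (A s) (B s))}.
Proof.
move=> cA cB; apply: (@eq_within_continuous _ _ _
  (fun s => \sum_j lam 0 j * \sum_i A s i j * B s i j)).
  by move=> s _; rewrite inner_LE.
apply: within_continuous_sum => j; apply: within_continuousM.
  exact: within_continuous_cst.
by apply: within_continuous_sum => i; exact: within_continuousM.
Qed.

Lemma mul_diag_trmxE (A B : 'M[R]_(n, k)) i j :
  (B *m diag_mx lam *m A^T) i j = \sum_l B i l * (lam 0 l * A j l).
Proof. by rewrite -mulmxA mul_diag_mx mxE; apply: eq_bigr => l _; rewrite !mxE. Qed.

Lemma source_continuous i j : {within `[a, b], continuous (fun s => source s i j)}.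
Proof.
apply: (@eq_within_continuous _ _ _
  (fun s => \sum_l j2 s i l * (lam 0 l * j1 s j l))).
  by move=> s _; rewrite mul_diag_trmxE.
apply: within_continuous_sum => l; apply: within_continuousM; first exact: jet_continuous.
by apply: within_continuousM; [exact: within_continuous_cst|exact: jet_continuous].
Qed.

(** On the orthogonal group [|g A|_L = |A|_L], so that the data term is affine
    in [g]. *)
Lemma energy_action g : H1_orthogonal a b g ->
  energy a b lam c1 c2 g =
  2^-1 * \int[mu]_(s in `[a, b]) (inner_L lam (j1 s) (j1 s) + inner_L lam (j2 s) (j2 s))
  + action a b source g (derive_on a b g).
Proof.
move=> H1; have adm := H1_admissible ab H1; have [og _ sg] := adm.
set D := derive_on a b g.
have i1 : mu.-integrable `[a, b] (EFin \o (fun s =>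
    inner_L lam (j1 s) (j1 s) + inner_L lam (j2 s) (j2 s))).
  apply: within_continuous_integrable; apply: within_continuousD;
    by apply: inner_L_continuous => i j; exact: jet_continuous.
have i2 : mu.-integrable `[a, b] (EFin \o (fun s => inner_o (g s) (source s))).
  apply: within_continuous_integrable; apply: continuous_inner_o.
    exact: source_continuous.
  by move=> i j; exact: admissible_continuous adm.
have i2z : mu.-integrable `[a, b] (EFin \o (fun s => (-2) * inner_o (g s) (source s))).
  exact: (integrableZl _ (-2) i2).
have i3 := square_integrable_inner_o sg sg.
have i12 : mu.-integrable `[a, b] (EFin \o (fun s =>
    inner_L lam (j1 s) (j1 s) + inner_L lam (j2 s) (j2 s) + (-2) * inner_o (g s) (source s))).
  exact: (integrableD _ i1 i2z).
have -> : action a b source g D = 2^-1 *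
   ((-2) * coupling a b source g + \int[mu]_(s in `[a, b]) inner_o (D s) (D s)).
  by rewrite /action kineticE//; field.
rewrite -mulrDr; congr (_ * _).
rewrite /coupling -RintegralZl// addrA -!RintegralD//.
apply: eq_Rintegral => s; rewrite inE => sab.
have gog : (g s)^T *m g s = 1%:M by exact: og.
have gg := invmx_orthogonal gog.
rewrite /norm_L /norm_o !sqr_sqrtr; [|by rewrite inner_o_pairE sumr_ge0// => ij _;
  rewrite -expr2 sqr_ge0|exact: inner_L_ge0].
congr (_ + _); last first.
  by rewrite gg inner_o_mull// trmxK; exact: mulmx1C.
rewrite -inner_L_source.
move: (j1 s) (j2 s) => A B; rewrite -(inner_L_mull A A gog).
move: (g s *m A) => X.
rewrite !inner_LE mulr_sumr -!big_split/=; apply: eq_bigr => j _.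
rewrite !mulr_sumr -!big_split/=; apply: eq_bigr => i _.
by rewrite !mxE; ring.
Qed.

End Energy.
Section Diamond.
Context {R : realType} (n k : nat).

(** The right-hand side is skew-symmetric, and [W] is half the combination of the
    [skew_basis i j] with coefficients [W i j] when [W] is skew-symmetric. *)
Lemma diamond_skew_basis (A : 'M[R]_(n, k)) (beta : {scalar 'M[R]_(n, k)}) :
  diamond A beta = \matrix_(i, j) (2^-1 * beta (skew_basis i j *m A)).
Proof.
apply/esym/diamond_unique => [|W skW].
  apply/matrixP => i j; rewrite !mxE -mulrN; congr (_ * _).
  by rewrite -linearN/= -mulNmx; congr (beta (_ *m _)); rewrite /skew_basis opprB.
have WE : \sum_i \sum_j W i j *: skew_basis i j = W + W.
  have E1 := matrix_sum_delta W.
  have E2 : \sum_i \sum_j W i j *: delta_mx j i = W^T.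
    rewrite exchange_big [RHS]matrix_sum_delta; apply: eq_bigr => i _.
    by apply: eq_bigr => j _; rewrite mxE.
  under eq_bigr => i _ do (under eq_bigr => j _ do rewrite scalerBr; rewrite sumrB).
  by rewrite sumrB -E1 E2 skW opprK.
have bWW : beta ((W + W) *m A) = 2 * beta (W *m A).
  by rewrite mulmxDl linearD/= mulr_natl mulr2n.
have -> : beta (W *m A) = 2^-1 * beta ((W + W) *m A) by rewrite bWW mulKf ?pnatr_eq0.
rewrite inner_oE -WE.
rewrite mulmx_suml linear_sum/= mulr_sumr; apply: eq_bigr => i _.
rewrite mulmx_suml linear_sum/= mulr_sumr; apply: eq_bigr => j _.
by rewrite mxE -scalemxAl linearZ/=; ring.
Qed.

End Diamond.

Theorem theorem6p1 (R : realType) (n k : nat) (a b : R)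
    (c1 c2 : R -> 'cV[R]_n) (lam : 'rV[R]_k) :
  (1 <= n)%N -> (1 <= k)%N -> a < b ->
  Ck_on k a b c1 -> Ck_on k a b c2 ->
  (forall i : 'I_k, 0 < lam 0 i) ->
  let E := energy a b lam c1 c2 in
  let is_minimizer g := H1_orthogonal a b g /\
    forall h, H1_orthogonal a b h -> E g <= E h in
  (exists g : R -> 'M[R]_n, is_minimizer g) /\
  (forall g : R -> 'M[R]_n, is_minimizer g ->
     let Omega s := invmx (g s) *m derive_on a b g s in
     (forall s, s \in `[a, b] ->
        derivable_on a b Omega s /\
        derive_on a b Omega s =
          diamond (invmx (g s) *m jet k a b c2 s) (flat lam (jet k a b c1 s))) /\
     Ck_on 2 a b g).
Proof.
move=> _ _ ab Ck1 Ck2 lam0 E is_minimizer.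
pose S := source a b lam c1 c2.
have cS : forall i j, {within `[a, b], continuous (fun s => S s i j)}.
  exact: source_continuous.
have EA := energy_action ab Ck1 Ck2 lam0.
have [g0 [phi0 [adm0 min0]]] := action_minimizer_exists ab cS.
have dg0 := minimizer_has_derive ab cS adm0 min0.
(* The minimizer among admissible pairs is continuously differentiable, hence
   competes in the original problem. *)
have H0 : H1_orthogonal a b g0.
  apply: (admissible_H1 ab adm0 dg0); apply: within_continuous_mulmx => i j.
    exact: admissible_continuous adm0.
  exact: is_primitive_continuous (body_velocity_primitive cS adm0 i j).
have act0 h psi : admissible a b h psi ->
    action a b S g0 (derive_on a b g0) <= action a b S h psi.
  move=> /min0; rewrite /action.
  by rewrite (admissible_kinetic_unique ab adm0 (H1_admissible ab H0)).
split.
  exists g0; split; first exact: H0.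
  move=> h Hh; rewrite /E (EA _ H0) (EA _ Hh) lerD2l.
  by apply: act0; exact: H1_admissible.
move=> g [Hg gmin] Omega; have adm := H1_admissible ab Hg.
(* Conversely, comparison with [g0] shows that a minimizer of the energy minimizes
   the action among admissible pairs, to which the regularity theory applies. *)
have min h psi : admissible a b h psi ->
    action a b S g (derive_on a b g) <= action a b S h psi.
  move=> /act0; apply: le_trans.
  by have := gmin g0 H0; rewrite /E (EA _ H0) (EA _ Hg) lerD2l.
pose Om := body_velocity a b S g.
pose dOm s : 'M[R]_n :=
  \matrix_(i, j) - (2^-1 * inner_o (g s *m skew_basis i j) (S s)).
have dg s : s \in `[a, b] -> has_derive_on a b g s (g s *m Om s).
  exact: (minimizer_has_derive ab cS adm min).
have dO s : s \in `[a, b] -> has_derive_on a b Om s (dOm s).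
  exact: (body_velocity_has_derive cS adm).
have gE s : s \in `[a, b] -> derive_on a b g s = g s *m Om s.
  by move=> sab; have [_] := has_derive_onE ab sab (dg s sab).
have og s : s \in `[a, b] -> (g s)^T *m g s = 1%:M by case: Hg => + _ _; exact.
have ginv s : s \in `[a, b] -> invmx (g s) = (g s)^T.
  by move=> sab; apply/invmx_orthogonal/og.
have OmE s : s \in `[a, b] -> Om s = Omega s.
  by move=> sab; rewrite /Omega gE// ginv// mulmxA og// mul1mx.
split=> [s sab|].
  have dOmega : has_derive_on a b Omega s (dOm s).
    by apply: (eq_has_derive_on sab OmE); exact: dO.
  have [dr ->] := has_derive_onE ab sab dOmega; split=> //.
  rewrite diamond_skew_basis; apply/matrixP => i j; rewrite mxE [RHS]mxE -mulrN.
  congr (_ * _); rewrite -inner_L_source ginv//.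
  rewrite [in LHS]/inner_L !trmx_mul.
  rewrite (skew_basis_unit i j).1.
  by rewrite !(mulmxA, mulmxN, mulNmx) raddfN/= opprK /flat /inner_L !mulmxA.
have cg i j : {within `[a, b], continuous (fun s => g s i j)}.
  exact: (@admissible_continuous _ _ _ _ _ _ i j adm).
have cOm i j : {within `[a, b], continuous (fun s => Om s i j)}.
  exact: is_primitive_continuous (body_velocity_primitive cS adm i j).
have cdOm i j : {within `[a, b], continuous (fun s => dOm s i j)}.
  apply: (@eq_within_continuous _ _ _
      (fun s => - 2^-1 * inner_o (g s *m skew_basis i j) (S s))).
    by move=> s _; rewrite mxE mulNr.
  apply: within_continuousM; first exact: within_continuous_cst.
  apply: continuous_inner_o => //; apply: within_continuous_mulmx => // p q.
  exact: within_continuous_cst.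
pose V s := g s *m Om s.
pose V' s := V s *m Om s + g s *m dOm s.
have dV s : s \in `[a, b] -> has_derive_on a b (derive_on a b g) s (V' s).
  move=> sab; apply: (eq_has_derive_on (f := V) sab) => [t tab|]; first by rewrite gE.
  exact: has_derive_on_mulmx (dg s sab) (dO s sab).
have V'E s : s \in `[a, b] -> derive_on a b (derive_on a b g) s = V' s.
  by move=> sab; have [_] := has_derive_onE ab sab (dV s sab).
split.
  move=> [|[|i]] //= _ s sab.
    by have [] := has_derive_onE ab sab (dg s sab).
  by have [] := has_derive_onE ab sab (dV s sab).
have cV i j : {within `[a, b], continuous (fun s => V s i j)}.
  by apply: within_continuous_mulmx.
move=> [|[|[|i]]] //= _; apply: within_continuous_mx => i j.
- exact: cg.
- by apply: (@eq_within_continuous _ _ _ (fun s => V s i j)) => // s sab; rewrite gE.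
- apply: (@eq_within_continuous _ _ _
      (fun s => (V s *m Om s) i j + (g s *m dOm s) i j)).
    by move=> s sab; rewrite V'E// [RHS]mxE.
  by apply: within_continuousD; apply: within_continuous_mulmx.
Qed.
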